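(* Let $R$ be any totally ordered semi-ring. There is an absolute constant $\epsilon>0$ such that for all sufficiently large $n$, if the perfect matching polynomial $PM_{n}$ (on $2n$ vertices) is a monotone affine projection of the permanent $\mathrm{perm}_m$ over $R$, then $m\geq 2^{\epsilon n}$. In particular, the family $(PM_n)$ is not a monotone affine p-projection of the family $(\mathrm{perm}_m)$.
   Context: A (commutative) totally ordered semi-ring is a totally ordered set $(R,\leq)$ with operations $\times,+$ and elements $1\neq 0$ such that $(R,\times,1)$, $(R,+,0)$ are commutative monoids, $\times$ distributes over $+$, $0\times a=0$, $a+c\leq b+c$ whenever $a\leq b$, and $ac\leq bc$ whenever $a\leq b$ and $0\leq c$. An element $c$ is non-negative if $0\leq c$. Polynomials are formal polynomials over $R$. The permanent is $\mathrm{perm}_m(Y)=\sum_{\pi\in S_m} y_{1,\pi(1)}\cdots y_{m,\pi(m)}$ in the $m^2$ variables $y_{ij}$. The perfect matching polynomial (''unsigned Pfaffian'') in variables $x_{ij}$, $1\leq i<j\leq 2n$, is $PM_n=\sum_{\pi}\prod_{i=1}^n x_{\pi(2i-1),\pi(2i)}$, the sum over $\pi\in S_{2n}$ with $\pi(1)<\pi(3)<\dots<\pi(2n-1)$ and $\pi(2k-1)<\pi(2k)$ for all $k$, i.e. the sum over all perfect matchings of the complete graph on $2n$ vertices of the product of their edge variables. A polynomial $f(x_1,\dots,x_N)$ is a monotone affine projection of $g(y_1,\dots,y_M)$ if $f$ is obtained from $g$ by substituting for each $y_i$ an affine linear function $a_0+a_1x_1+\dots+a_Nx_N$ with all $a_k\in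 R$ non-negative. A family $(f_n)$ is a monotone affine p-projection of $(g_m)$ if there is a polynomially bounded $p$ with $f_n$ a monotone affine projection of $g_{p(n)}$ for all sufficiently large $n$. *)

(* Defs.v *)
From HB Require Import structures.
From mathcomp Require Import all_boot all_order all_algebra all_fingroup.
From mathcomp Require Import finmap.
From mathcomp Require Import reals exp.

Set Implicit Arguments.
Unset Strict Implicit.
Unset Printing Implicit Defensive.

Import Order.TTheory GRing.Theory Num.Theory.

Local Open Scope fset_scope.
Local Open Scope ring_scope.

(* The order is a field of the structure, because Hierarchy Builder admits no
   join of MathComp's additive monoids and orders other than the ordered abelian
   groups. It is compatible with multiplication by non-negative elements only;
   neither 0 <= 1 nor the absence of zero divisors is assumed. *)
HB.mixin Record ComNzSemiRing_isTotalOrdered R of GRing.ComNzSemiRing R := {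
  tosr_le : rel R;
  tosr_le_refl : reflexive tosr_le;
  tosr_le_anti : antisymmetric tosr_le;
  tosr_le_trans : transitive tosr_le;
  tosr_le_total : total tosr_le;
  tosr_leD2r : forall a b c : R, tosr_le a b -> tosr_le (a + c) (b + c);
  tosr_leM2r : forall a b c : R,
    tosr_le a b -> tosr_le 0 c -> tosr_le (a * c) (b * c)
}.

#[short(type="totalOrderSemiRingType")]
HB.structure Definition TotalOrderSemiRing :=
  {R of GRing.ComNzSemiRing R & ComNzSemiRing_isTotalOrdered R}.

Definition nonneg (R : totalOrderSemiRingType) (c : R) : bool := tosr_le 0 c.

(* Formal polynomials in variables indexed by a finite type V, with
   coefficients in a commutative semiring. Multinomials' {mpoly R[n]} and
   {malg R[K]} need subtraction in the coefficients, so the construction of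
   {malg R[K]} is repeated here: a polynomial is its finitely supported
   coefficient function on the exponent vectors {ffun V -> nat}, and the product
   is convolution. *)
Notation monom V := {ffun V -> nat}.

Section PolynomialType.
Variables (V : finType) (R : comNzSemiRingType).

Record spoly : predArgType :=
  SPoly { spoly_val : {fsfun monom V -> R with 0} }.

HB.instance Definition _ := [isNew for @spoly_val].
HB.instance Definition _ := [Choice of spoly by <:].

End PolynomialType.

Bind Scope ring_scope with spoly.
Notation "{ 'spoly' R [ V ] }" := (@spoly V%type R)
  (at level 0, R, V at level 2, format "{ 'spoly'  R [ V ] }") : type_scope.

Section PolynomialBase.
Variables (V : finType) (R : comNzSemiRingType).
Implicit Types (p q : {spoly R[V]}) (k : monom V).

Definition spcoef k p : R := spoly_val p k.
Definition spsupp p : {fset monom V} := finsupp (spoly_val p).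
(* The monomial c * X^k. *)
Definition spmono k (c : R) : {spoly R[V]} :=
  SPoly [fsfun m in [fset k] => c].

Lemma spolyP p q : (forall k, spcoef k p = spcoef k q) <-> p = q.
Proof.
by case: p q => [p] [q]; split=> [h|->//]; congr SPoly; apply/fsfunP/h.
Qed.

Lemma spcoef_out p k : k \notin spsupp p -> spcoef k p = 0.
Proof. exact: fsfun_dflt. Qed.

Lemma spcoef_neq0 p k : (spcoef k p != 0) = (k \in spsupp p).
Proof. by rewrite mem_finsupp. Qed.

Lemma spcoef_mono k c k' : spcoef k' (spmono k c) = c *+ (k == k').
Proof. by rewrite /spcoef fsfun_fun in_fset1 eq_sym; case: eqP. Qed.

Lemma spcoef_monoE k c : spcoef k (spmono k c) = c.
Proof. by rewrite spcoef_mono eqxx. Qed.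

Definition spzero : {spoly R[V]} := SPoly [fsfun].
Definition spadd p q : {spoly R[V]} :=
  SPoly [fsfun k in spsupp p `|` spsupp q => spcoef k p + spcoef k q].

Lemma spzeroE k : spcoef k spzero = 0.
Proof. by rewrite /spcoef fsfun0E. Qed.

Lemma spaddE p q k : spcoef k (spadd p q) = spcoef k p + spcoef k q.
Proof.
rewrite {1}/spcoef fsfun_fun in_fsetU.
case: (boolP (k \in spsupp p)) => //= /spcoef_out ->.
by case: (boolP (k \in spsupp q)) => //= /spcoef_out ->; rewrite addr0.
Qed.

Lemma spaddA : associative spadd.
Proof. by move=> x y z; apply/spolyP=> k; rewrite !spaddE addrA. Qed.

Lemma spaddC : commutative spadd.
Proof. by move=> x y; apply/spolyP=> k; rewrite !spaddE addrC. Qed.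

Lemma spadd0p : left_id spzero spadd.
Proof. by move=> x; apply/spolyP=> k; rewrite spaddE spzeroE add0r. Qed.

HB.instance Definition _ :=
  GRing.isNmodule.Build {spoly R[V]} spaddA spaddC spadd0p.

Lemma spcoef_is_nmod_morphism k : nmod_morphism (spcoef k).
Proof. by split=> [|p q]; [exact: spzeroE|exact: spaddE]. Qed.

HB.instance Definition _ k :=
  GRing.isNmodMorphism.Build {spoly R[V]} R (spcoef k)
    (spcoef_is_nmod_morphism k).

Lemma spmono_is_nmod_morphism k : nmod_morphism (spmono k).
Proof.
split=> [|a b]; apply/spolyP=> k'; rewrite spcoef_mono.
  by rewrite mul0rn raddf0.
by rewrite raddfD /= !spcoef_mono mulrnDl.
Qed.

HB.instance Definition _ k :=
  GRing.isNmodMorphism.Build R {spoly R[V]} (spmono k)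
    (spmono_is_nmod_morphism k).

Lemma spsupp0 : spsupp (0 : {spoly R[V]}) = fset0.
Proof. by apply/fsetP=> k; rewrite -spcoef_neq0 raddf0 eqxx. Qed.

Lemma spsupp_mono_le k c : spsupp (spmono k c) `<=` [fset k].
Proof.
apply/fsubsetP=> k'; rewrite -spcoef_neq0 spcoef_mono in_fset1 [k' == k]eq_sym.
by case: (k == k') => //; rewrite mulr0n eqxx.
Qed.

Lemma spsuppD_le p q : spsupp (p + q) `<=` spsupp p `|` spsupp q.
Proof.
apply/fsubsetP=> k; rewrite in_fsetU -!spcoef_neq0 raddfD /=; apply: contraR.
by rewrite negb_or !negbK => /andP[/eqP-> /eqP->]; rewrite addr0.
Qed.

Lemma spolyE p : p = \sum_(k <- spsupp p) spmono k (spcoef k p).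
Proof.
apply/spolyP=> k; rewrite raddf_sum /=.
case: (boolP (k \in spsupp p)) => kp.
  rewrite (big_fsetD1 k) //= spcoef_monoE big1_fset ?addr0 // => k'.
  by rewrite in_fsetD1 spcoef_mono; case: eqP.
rewrite (spcoef_out kp) big1_fset // => k' k'p _.
by rewrite spcoef_mono; case: eqP k'p kp => // -> ->.
Qed.

Definition spone : {spoly R[V]} := spmono 0 1.
Definition spmul p q : {spoly R[V]} :=
  \sum_(k <- spsupp p) \sum_(l <- spsupp q)
     spmono (k + l) (spcoef k p * spcoef l q).

Lemma spmulw (d1 d2 : {fset monom V}) p q :
  spsupp p `<=` d1 -> spsupp q `<=` d2 ->
  spmul p q = \sum_(k <- d1) \sum_(l <- d2)
                 spmono (k + l) (spcoef k p * spcoef l q).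
Proof.
move=> le1 le2; rewrite /spmul (big_fset_incl _ le1) /=.
  apply/eq_bigr=> k _; apply/big_fset_incl => // l _ /spcoef_out ->.
  by rewrite mulr0 raddf0.
by move=> k _ /spcoef_out ->; rewrite big1 // => l _; rewrite mul0r raddf0.
Qed.

Lemma spmulC : commutative spmul.
Proof.
move=> p q; rewrite /spmul exchange_big /=.
by apply: eq_bigr => k _; apply: eq_bigr => l _; rewrite addrC mulrC.
Qed.

Lemma spmul0p : left_zero 0 spmul.
Proof. by move=> p; rewrite /spmul spsupp0 big_seq_fset0. Qed.

Lemma spmulDl : left_distributive spmul +%R.
Proof.
move=> p q r.
rewrite (@spmulw _ _ _ r (spsuppD_le p q) (fsubset_refl _)).
rewrite (@spmulw _ _ p r (fsubsetUl _ (spsupp q)) (fsubset_refl _)).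
rewrite (@spmulw _ _ q r (fsubsetUr (spsupp p) _) (fsubset_refl _)).
rewrite -big_split /=; apply: eq_bigr => k _.
rewrite -big_split /=; apply: eq_bigr => l _.
by rewrite raddfD /= mulrDl raddfD.
Qed.

Lemma spmulp0 : right_zero 0 spmul.
Proof. by move=> p; rewrite spmulC spmul0p. Qed.

Lemma spmulDr : right_distributive spmul +%R.
Proof. by move=> p q r; rewrite spmulC spmulDl ![spmul _ p]spmulC. Qed.

Lemma spmul_mono k l c d :
  spmul (spmono k c) (spmono l d) = spmono (k + l) (c * d).
Proof.
rewrite (spmulw (spsupp_mono_le k c) (spsupp_mono_le l d)).
by rewrite !big_seq_fset1 !spcoef_monoE.
Qed.

Lemma spmul_suml (I : Type) (s : seq I) (F : I -> {spoly R[V]}) q :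
  spmul (\sum_(i <- s) F i) q = \sum_(i <- s) spmul (F i) q.
Proof.
exact: (big_morph (spmul^~ q) (fun _ _ => spmulDl _ _ _) (spmul0p _)).
Qed.

Lemma spmul_sumr (I : Type) (s : seq I) (F : I -> {spoly R[V]}) p :
  spmul p (\sum_(i <- s) F i) = \sum_(i <- s) spmul p (F i).
Proof.
exact: (big_morph (spmul p) (fun _ _ => spmulDr _ _ _) (spmulp0 _)).
Qed.

Lemma spmulA : associative spmul.
Proof.
move=> p q r; rewrite (spolyE p) !spmul_suml; apply: eq_bigr => k _.
rewrite (spolyE q) spmul_suml !spmul_sumr spmul_suml; apply: eq_bigr => l _.
rewrite (spolyE r) !spmul_sumr; apply: eq_bigr => m _.
by rewrite !spmul_mono mulrA addrA.
Qed.

Lemma spmul1p : left_id spone spmul.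
Proof.
move=> p; rewrite {1}(spolyE p) spmul_sumr [RHS]spolyE.
by apply: eq_bigr => k _; rewrite spmul_mono mul1r add0r.
Qed.

Lemma spone_neq0 : spone != 0.
Proof.
apply/eqP => /(congr1 (spcoef 0)) /eqP.
by rewrite raddf0 spcoef_monoE oner_eq0.
Qed.

HB.instance Definition _ :=
  GRing.Nmodule_isComNzSemiRing.Build {spoly R[V]}
    spmulA spmulC spmul1p spmulDl spmul0p spone_neq0.

Definition spconst (c : R) : {spoly R[V]} := spmono 0 c.

Definition spvar (v : V) : {spoly R[V]} :=
  spmono [ffun w => nat_of_bool (w == v)] 1.

End PolynomialBase.

(* [spsubst l g] substitutes the polynomial l w for each variable w in g. *)
Definition spsubst (V W : finType) (R : comNzSemiRingType)
    (l : W -> {spoly R[V]}) (g : {spoly R[W]}) : {spoly R[V]} :=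
  \sum_(k <- spsupp g) spconst V (spcoef k g) * \prod_(w : W) l w ^+ k w.

Definition nonneg_affine (V : finType) (R : totalOrderSemiRingType)
    (l : {spoly R[V]}) : Prop :=
  exists (a0 : R) (a : V -> R),
    [/\ nonneg a0, forall v, nonneg (a v)
      & l = spconst V a0 + \sum_(v : V) spconst V (a v) * spvar R v].

Definition monotone_affine_projection (V W : finType)
    (R : totalOrderSemiRingType) (f : {spoly R[V]}) (g : {spoly R[W]}) : Prop :=
  exists l : W -> {spoly R[V]},
    (forall w, nonneg_affine (l w)) /\ f = spsubst l g.

Definition polynomially_bounded (p : nat -> nat) : Prop :=
  exists q : {poly nat}, forall n, (p n <= q.[n])%N.

Definition monotone_affine_p_projection (V W : nat -> finType)
    (R : totalOrderSemiRingType) (f : forall n, {spoly R[V n]})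
    (g : forall m, {spoly R[W m]}) : Prop :=
  exists2 p : nat -> nat, polynomially_bounded p
    & exists n0 : nat, forall n, (n0 <= n)%N ->
        monotone_affine_projection (f n) (g (p n)).

Definition permanent (R : comNzSemiRingType) (m : nat) :
    {spoly R['I_m * 'I_m]} :=
  \sum_(s : 'S_m) \prod_(i < m) spvar R (i, s i).

(* Edges of the complete graph on n.*2 vertices, with vertices numbered from 0
   instead of from 1. *)
Definition edge (n : nat) : finType :=
  {e : 'I_n.*2 * 'I_n.*2 | (e.1 < e.2)%N}.

Lemma even_pos_subproof n (i : 'I_n) : (i.*2 < n.*2)%N.
Proof. by rewrite ltn_double. Qed.

Lemma odd_pos_subproof n (i : 'I_n) : (i.*2.+1 < n.*2)%N.
Proof. by rewrite ltn_Sdouble. Qed.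

(* With positions numbered from 0, the positions 2k-1 and 2k for 1 <= k <= n
   become 2i and 2i+1 for 0 <= i < n. *)
Definition even_pos n (i : 'I_n) : 'I_n.*2 := Ordinal (even_pos_subproof i).
Definition odd_pos n (i : 'I_n) : 'I_n.*2 := Ordinal (odd_pos_subproof i).

(* Each perfect matching is represented by exactly one such permutation. *)
Definition matching_perm n (s : 'S_n.*2) : bool :=
  [forall i : 'I_n, forall j : 'I_n,
     (i < j)%N ==> (s (even_pos i) < s (even_pos j))%N]
  && [forall i : 'I_n, (s (even_pos i) < s (odd_pos i))%N].

(* The default value 0 is never reached in [PM] below, as [matching_perm]
   guarantees that the two endpoints are increasing. *)
Definition edge_var (R : comNzSemiRingType) n (a b : 'I_n.*2) :
    {spoly R[edge n]} :=
  if insub (a, b) is Some e then spvar R (e : edge n) else 0.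

Definition PM (R : comNzSemiRingType) (n : nat) : {spoly R[edge n]} :=
  \sum_(s : 'S_n.*2 | matching_perm s)
    \prod_(i < n) edge_var R (s (even_pos i)) (s (odd_pos i)).

(* Main.v *)
(* By LP duality for bipartite matchings (here: Hall's theorem), a monotone
   projection of perm_m onto PM_n writes the slack |delta(U) /\ M| - 1 of every
   odd-cut inequality at every perfect matching M as a sum of polynomially many
   (in m and n) 0/1 rectangles P(U) R(M). Rothvoss' argument shows that
   exponentially many are needed. A rectangle avoids all pairs with one crossing
   edge. Inside a random block structure, U and M are nearly uniform on all but a
   few coordinates of any rectangle that is not tiny. When they are, a k-matching F
   between two special k-sets cannot have two triples of edges, meeting in exactly
   one edge, that both look uniform, since recombining U from one and M from
   the other would give a pair with one crossing. Hence only O(k) of the 'C(k, 3)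
   triples are good, so that the mass of the rectangle on pairs with 3 crossings is
   at most O(1/k^2) times its mass on pairs with k crossings, up to small errors.
   Summed over the rectangles, the slacks 2 and k - 1 are incompatible with this
   unless the number of tiny errors is exponential. *)
Require Import Defs.
From mathcomp Require Import all_boot all_order all_algebra.
From mathcomp Require Import all_fingroup finmap boolp ring lra zify.
From mathcomp Require Import reals exp.

Set Implicit Arguments.
Unset Strict Implicit.
Unset Printing Implicit Defensive.

Import Order.TTheory GRing.Theory Num.Theory.

(** * Triples meeting in exactly one point *)

(** The block size [h] is a constant, so the alphabets of the blocks are fixed while the number [m]
    of blocks grows linearly with [n]; being biased in a fixed fraction of the coordinates then
    costs a set a factor exponential in [n]. Averaging runs over all relabellings [p] of the
    vertices: every pair that is compared is a gadget pair moved by [p], and every symmetry is left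
    multiplication of [p] by a vertex permutation that fixes the gadget cut, the gadget matching, or
    both. No single distribution on pairs with 3 crossings has enough of these symmetries.
    Exchanging B-blocks preserves a cut that avoids C outside the triple, while exchanging A-blocks
    preserves a matching that stays within C and within D there. Hence there are two such
    distributions, and unbiased matchings allow mass to pass from the first to the second. On the
    algebraic side, the semiring may have zero divisors and 0 <= 1 has to be derived from the
    projection itself. What is kept of the coefficients is a Boolean relation between entries and
    labels, so the final constant does not depend on the semiring. *)

(* Fix a maximal packing [P] of pairwise disjoint members. Any other member is
   [x |: (A :\ c)] with [A \in P] and [c \in A], and [x] determines [A]. *)
Lemma triple_family_bound (T : finType) (g : {set {set T}}) :
  (forall H, H \in g -> #|H| = 3) ->
  (forall H1 H2, H1 \in g -> H2 \in g -> #|H1 :&: H2| != 1)%N ->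
  (#|g| <= 4 * #|T|)%N.
Proof.
move=> card3 meet; pose p (P : {set {set T}}) := (P \subset g) && trivIset P.
have p0 : p set0.
  by rewrite /p sub0set; apply/trivIsetP => A B; rewrite inE.
have [P /maxsetP[/andP[Pg trivP] maxP] _] := maxset_exists p0.
have meetP H : H \in g -> H \notin P -> exists2 A, A \in P & #|H :&: A| == 2.
  move=> Hg HP.
  have [A AP AH] : exists2 A, A \in P & H :&: A != set0.
    apply/exists_inP; apply: contraR HP => /exists_inPn disj.
    rewrite -(maxP (H |: P)) ?setU11 ?subsetUr // /p subUset sub1set Hg Pg /=.
    have dis B : B \in P -> [disjoint H & B].
      by move=> BP; rewrite -setI_eq0; have := disj _ BP; rewrite negbK.
    apply/trivIsetP => A B /setU1P[->|AP] /setU1P[->|BP] neqAB.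
    - by rewrite eqxx in neqAB.
    - exact: dis.
    - by rewrite disjoint_sym; exact: dis.
    - exact: (trivIsetP trivP).
  exists A => //; have Ag := subsetP Pg _ AP.
  have := meet _ _ Hg Ag; move: AH; rewrite -card_gt0.
  have : (#|H :&: A| < 3)%N.
    rewrite -(card3 _ Hg) ltn_neqAle subset_leq_card ?subsetIl // andbT.
    apply: contra HP => /eqP cardI.
    have HA : H \subset A by apply/setIidPl/eqP; rewrite eqEcard subsetIl cardI leqnn.
    suff -> : H = A by [].
    by apply/eqP; rewrite eqEcard HA (card3 _ Hg) (card3 _ Ag).
  by case: #|_| => [|[|[|]]].
have repr H A : H \in g -> A \in g -> #|H :&: A| == 2 ->
    exists x, exists2 c, c \in A & H = x |: (A :\ c) /\ x \notin A.
  move=> Hg Ag /eqP card2.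
  have /cards1P[x HDA] : #|H :\: A| == 1%N by rewrite cardsD card3 // card2.
  have /cards1P[c ADH] : #|A :\: H| == 1%N by rewrite cardsD card3 // setIC card2.
  exists x, c; first by have := set11 c; rewrite -ADH inE => /andP[].
  split; last by have := set11 x; rewrite -HDA inE => /andP[].
  by rewrite -ADH setDDr setDv set0U -HDA setIC setUC setID.
have cardP : (#|P| <= #|T|)%N.
  have le_cover : #|cover P| <= #|T| by exact: max_card.
  apply: leq_trans le_cover; rewrite -(eqP trivP) -sum1_card.
  by apply: leq_sum => A AP; rewrite (card3 _ (subsetP Pg _ AP)).
pose ext (x : T) :=
  [set H in g :\: P | [exists A in P, (#|H :&: A| == 2) && (x \in H :\: A)]].
have card_ext x : #|ext x| <= 3.
  rewrite /ext.
  set S := [set _ in _ | _].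
  have [->|/set0Pn[H0]] := eqVneq S set0; first by rewrite cards0.
  rewrite !inE => /andP[/andP[H0P H0g] /exists_inP[A AP /andP[H0A xH0A]]].
  have Ag := subsetP Pg _ AP.
  apply: leq_trans (_ : #|[set x |: (A :\ c) | c in A]| <= 3)%N; last first.
    by rewrite -(card3 _ Ag) leq_imset_card.
  have charact H B : H \in g -> B \in P -> #|H :&: B| == 2 -> x \in H :\: B ->
      exists2 c, c \in B & H = x |: (B :\ c).
    move=> Hg BP card2; have [y [c cB [-> yB]]] := repr _ _ Hg (subsetP Pg _ BP) card2.
    rewrite !inE => /andP[xB /orP[/eqP->|/andP[_]]]; first by exists c.
    by rewrite (negPf xB).
  have [c0 c0A defH0] := charact _ _ H0g AP H0A xH0A.
  apply/subset_leq_card/subsetP => H; rewrite !inE.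
  move=> /andP[/andP[HP Hg] /exists_inP[B BP /andP[HB xHB]]].
  have [c cB defH] := charact _ _ Hg BP HB xHB.
  have [eqAB|neqAB] := eqVneq A B; first by apply/imsetP; exists c; rewrite ?eqAB.
  have /pred0P disAB := trivIsetP trivP _ _ AP BP neqAB.
  (* Extensions by the same [x] of two disjoint members of the packing would meet in [x] alone. *)
  suff : #|H0 :&: H| == 1%N by rewrite (negPf (meet _ _ H0g Hg)).
  suff -> : H0 :&: H = [set x] by rewrite cards1.
  rewrite defH0 defH -setUIr -[RHS]setU0; congr (_ :|: _); apply/setP => z.
  by have := disAB z; rewrite !inE /=; case: (z \in A); case: (z \in B); rewrite ?andbF.
have -> : #|g| = (#|P| + #|g :\: P|)%N.
  by rewrite -(cardsID P g) (setIidPr Pg).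
(* The factor 4 is 1 for the packing plus 3 for the extensions by each point [x]. *)
suff : (#|g :\: P| <= #|T| * 3)%N by lia.
rewrite -sum_nat_const.
apply: (@leq_trans (\sum_(x : T) #|ext x|)); last by apply: leq_sum => x _;
  exact: card_ext.
rewrite -sum1_card /ext.
under [leqRHS]eq_bigr do rewrite -sum1_card.
rewrite (exchange_big_dep [in g :\: P]) /=; last by move=> x H _; rewrite inE => /andP[].
apply: leq_sum => H HgP; move: (HgP); rewrite inE => /andP[HP Hg].
have [A AP card2] := meetP _ Hg HP.
have [x [c _ [defH xA]]] := repr _ _ Hg (subsetP Pg _ AP) card2.
rewrite (bigD1 x) //= inE HgP; apply/exists_inP; exists A => //.
by rewrite card2 inE xA defH setU11.
Qed.

(** List each set followed by its complement and match the two listings. This carries the standard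
    triple of edges to any other triple. *)
Lemma perm_imset_exists (T : finType) (A B : {set T}) :
  #|A| = #|B| -> exists s : {perm T}, [set s x | x in A] = B.
Proof.
move=> cardAB; have cardC : #|~: A| = #|~: B| 
  by apply: (@addnI #|A|); rewrite {2}cardAB !cardsC.
pose e (C : {set T}) := enum C ++ enum (~: C).
have uniq_e C : uniq (e C).
  rewrite cat_uniq !enum_uniq andbT /=; apply/hasPn => x.
  by rewrite !mem_enum inE.
have mem_e C x : x \in e C by rewrite mem_cat !mem_enum inE orbN.
have size_e : size (e A) = size (e B) by rewrite !size_cat -!cardE cardAB cardC.
have lt_e x : index x (e A) < size (e B) by rewrite -size_e index_mem.
have s_inj : injective (fun x => nth x (e B) (index x (e A))).
  move=> x y; rewrite (set_nth_default x y) // => /eqP.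
  rewrite nth_uniq // => /eqP eq_idx.
  by rewrite -(nth_index x (mem_e A x)) eq_idx nth_index.
exists (perm s_inj); apply/eqP; rewrite eqEcard card_imset ?cardAB ?leqnn ?andbT;
  last exact: perm_inj.
apply/subsetP => _ /imsetP[x xA ->];
  rewrite permE /= /e index_cat mem_enum xA nth_cat -cardE.
have idx : index x (enum A) < #|A| by rewrite cardE index_mem mem_enum.
by rewrite -cardAB idx -mem_enum mem_nth // -cardE -cardAB.
Qed.

Lemma involution_card_even (T : finType) (f : T -> T) (A : {set T}) :
  involutive f -> (forall x, f x != x) -> {in A, forall x, f x \in A} ->
  ~~ odd #|A|.
Proof.
move=> fK f_neq fA; pose lo := [set x in A | enum_rank x < enum_rank (f x)].
have f_inj := can_inj fK.
suff -> : #|A| = #|lo| + #|f @: lo| by rewrite card_imset // addnn odd_double.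
rewrite -(cardsID lo A) (setIidPr _); last by apply/subsetP => x; rewrite inE => /andP[].
congr (_ + _); apply: eq_card => x; rewrite !inE; apply/idP/imsetP.
  move=> /andP[nlo xA]; exists (f x); rewrite ?fK // inE fA // fK.
  move: nlo; rewrite xA /= -leqNgt leq_eqVlt => /orP[/eqP/val_inj/enum_rank_inj/eqP|//].
  by rewrite (negPf (f_neq x)).
move=> [y]; rewrite inE => /andP[yA lt_y] ->; rewrite fA // fK andbT /=.
by rewrite -leqNgt ltnW.
Qed.

(** * Biased coordinates *)

Local Open Scope ring_scope.

Section Bias.
Variables (K : realFieldType) (I Q : finType).
Implicit Types (S : {set {ffun I -> Q}}) (J : {set I}).

Definition fiber S i v : {set {ffun I -> Q}} := [set y in S | y i == v].

(** Some value has less than half of its fair share [#|S| / #|Q|]. Only rarity counts as bias: an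
    unbiased coordinate is one where every value keeps a constant share of the set. *)
Definition biased S i : bool :=
  [exists v, (2 * #|Q| * #|fiber S i v| < #|S|)%N].

Definition hits J (v : I -> Q) (y : {ffun I -> Q}) : nat :=
  \sum_(i in J) (y i == v i).

Lemma sum_hits S J v :
  (forall i, i \in J -> 2 * #|Q| * #|fiber S i (v i)| <= #|S|)%N ->
  (2 * #|Q| * \sum_(y in S) hits J v y <= #|J| * #|S|)%N.
Proof.
move=> rareJ; rewrite /hits exchange_big /= big_distrr /= -sum_nat_const.
apply: leq_sum => i iJ; apply: leq_trans (rareJ _ iJ).
rewrite leq_mul2l; apply/orP; right.
rewrite -sum1_card [leqRHS](eq_bigl (fun y => (y \in S) && (y i == v i))); last first.
  by move=> y; rewrite inE.
by rewrite big_mkcondr.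
Qed.

(** Markov: the mean number of hits is at most [#|J| / (2 #|Q|)] and the threshold is 3/2 of that,
    so at most two thirds of [S] exceed it. *)
Lemma few_hits_large S J v :
  (forall i, i \in J -> 2 * #|Q| * #|fiber S i (v i)| <= #|S|)%N ->
  (#|S| <= 3 * #|[set y in S | 4 * #|Q| * hits J v y <= 3 * #|J|]|)%N.
Proof.
move=> rareJ; have := sum_hits rareJ.
set S' := [set y in S | _].
have [J0|J_gt0] := posnP #|J|.
  suff -> : S' = S by lia.
  apply/setP => y; rewrite inE; case: (y \in S) => //=.
  by rewrite /hits (cards0_eq J0) big_set0 cards0; lia.
move=> le_sum.
have -> : #|S| = (#|S'| + #|S :\: S'|)%N.
  by rewrite cardsD (setIidPr _) ?subnKC ?subset_leq_card //;
    apply/subsetP => y; rewrite inE => /andP[].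
have: (#|S :\: S'| * (3 * #|J|) <= 4 * #|Q| * \sum_(y in S) hits J v y)%N.
  rewrite -sum_nat_const big_distrr /=.
  rewrite [leqRHS](bigID [pred y | y \in S']) /= addnC; apply: leq_trans (leq_addr _ _).
  rewrite [leqRHS](eq_bigl [in S :\: S']); last by move=> y; rewrite !inE andbC.
  by apply: leq_sum => y; rewrite !inE => /andP[/nandP[/negP//|]];
    rewrite -ltnNge => /ltnW.
move: le_sum; have -> : #|S| = (#|S'| + #|S :\: S'|)%N.
  by rewrite cardsD (setIidPr _) ?subnKC ?subset_leq_card //;
    apply/subsetP => y; rewrite inE => /andP[].
nia.
Qed.

(** Exponential moment: a function with few hits has [s ^+ (4 #|Q| hits) >= s ^+ (3 #|J|)], and the
    sum of the left side over all functions factors over the coordinates, with factor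
    [#|Q| - 1 + s ^+ (4 #|Q|)] on [J]. *)
Lemma few_hits_small J v (s rho : K) : 0 < s -> s <= 1 -> 0 <= rho ->
  #|Q|%:R - 1 + s ^+ (4 * #|Q|) <= #|Q|%:R * (s ^+ 3 * rho) ->
  #|[set y | 4 * #|Q| * hits J v y <= 3 * #|J|]%N|%:R
     <= #|Q|%:R ^+ #|I| * rho ^+ #|J|.
Proof.
move=> s0 s1 rho0 le_srho; set q := #|Q| in le_srho *.
have s3 : 0 < s ^+ (3 * #|J|) by exact: exprn_gt0.
rewrite -(ler_pM2r s3).
apply: (@le_trans _ _ (\sum_(y : {ffun I -> Q}) \prod_i
   (if i \in J then s ^+ (4 * q * (y i == v i)) else 1))).
  rewrite -sumr_const big_mkcond mulr_suml /=.
  apply: ler_sum => y _; rewrite -big_mkcond /= prodrXr -big_distrr /=.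
  rewrite inE; case: ifP => [le|_]; last by rewrite mul0r exprn_ge0 // ltW.
  by rewrite mul1r; apply: ler_wiXn2l => //; exact: ltW.
rewrite -(bigA_distr_bigA (fun i x => if i \in J then s ^+ (4 * q * (x == v i)) else 1)).
rewrite (eq_bigr (fun i => if i \in J then q%:R - 1 + s ^+ (4 * q) else q%:R)) =>
  [|i _]; last first.
  case: ifP => iJ; last by rewrite sumr_const.
  rewrite (bigD1 (v i)) //= eqxx muln1 (eq_bigr (fun=> 1)); last first.
    by move=> x /negPf ->; rewrite muln0.
  rewrite sumr_const addrC cardC1; congr (_ + _).
  by rewrite -subn1 natrB //; apply/card_gt0P; exists (v i).
apply: (@le_trans _ _ (\prod_i (q%:R * (if i \in J then s ^+ 3 * rho else 1)))).
  apply: ler_prod => i _; case: ifP => _; last by rewrite mulr1 lexx ler0n.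
  apply/andP; split => //; apply: addr_ge0; last by rewrite exprn_ge0 // ltW.
  by rewrite subr_ge0 ler1n; apply/card_gt0P; exists (v i).
rewrite big_split /= prodr_const -big_mkcond /= prodr_const exprMn -exprM.
by rewrite mulrA mulrAC.
Qed.

(** With [s = 1 - u], the left side is [q - 4 q u] to first order and [q s^3] is [q - 3 q u]. The
    choice [u = 1 / (20 q)] gives [4 q u = 1/5], hence [s ^+ (4 q) >= 4/5], and the true decrease on
    the left is still at least [(16/5) q u]. *)
Lemma bias_parameters (q : nat) : (0 < q)%N ->
  exists s rho : K, [/\ 0 < s, s <= 1, 0 <= rho, rho < 1
    & q%:R - 1 + s ^+ (4 * q) <= q%:R * (s ^+ 3 * rho)].
Proof.
move=> q_gt0; have q1 : 1 <= q%:R :> K by rewrite ler1n.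
have q0 : 0 < q%:R :> K by rewrite ltr0n.
pose u : K := (20 * q%:R)^-1.
have u0 : 0 < u by rewrite invr_gt0 mulr_gt0.
have uq : u * q%:R = 20^-1 by rewrite /u invfM -mulrA mulVf ?mulr1 // lt0r_neq0.
have u1 : u < 1 by nra.
pose s := 1 - u.
have s0 : 0 < s by rewrite subr_gt0.
have s1 : s <= 1 by rewrite lerBlDr lerDl ltW.
have bern n : 1 - n%:R * u <= s ^+ n.
  elim: n => [|n IH]; first by rewrite mul0r subr0 expr0.
  have : 0 <= n%:R * u * u by rewrite !mulr_ge0 ?ler0n // ltW.
  by rewrite exprS -natr1 /s in IH *; nra.
have s3 : 0 < s ^+ 3 by exact: exprn_gt0.
have low : 4/5 <= s ^+ (4 * q).
  apply: le_trans (bern _); rewrite natrM -mulrA [q%:R * u]mulrC uq; lra.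
have up : s ^+ (4 * q) <= 1 - 4 * q%:R * u * (4/5).
  have key n : n%:R * u * s ^+ n <= 1 - s ^+ n.
    elim: n => [|n IH]; first by rewrite mul0r mul0r expr0 subrr.
    have sn0 : 0 < s ^+ n by exact: exprn_gt0.
    have := mulr_ge0 (ler0n K n) (ltW (mulr_gt0 u0 sn0)) => t0.
    have := mulr_ge0 (ltW u0) t0.
    by rewrite exprS -natr1 /s in IH sn0 t0 *; nra.
  have := key (4 * q)%N; rewrite natrM.
  have : 0 < 4 * q%:R * u by rewrite !mulr_gt0.
  nra.
have low3 : 1 - 3 * u <= s ^+ 3 by exact: (bern 3%N).
exists s, ((q%:R - 1 + s ^+ (4 * q)) / (q%:R * s ^+ 3)); split => //.
- by rewrite divr_ge0 ?mulr_ge0 ?ltW // ltr_wpDl ?subr_ge0 // exprn_gt0.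
- rewrite ltr_pdivrMr ?mulr_gt0 // mul1r.
  have : q%:R * (1 - 3 * u) <= q%:R * s ^+ 3 by rewrite ler_pM2l.
  nra.
- by rewrite mulrA mulrC divfK // mulf_neq0 ?lt0r_neq0.
Qed.

End Bias.

(* A set of density above [3 * theta ^+ #|I|] has few biased coordinates: a
   rare value in each coordinate of [J] forces, by Markov, a third of the set
   to hit those values at most [3/4] of the expected number of times, and an
   exponential moment bounds the number of such functions. *)
Lemma few_biased (K : realFieldType) (q E : nat) : (0 < q)%N -> (0 < E)%N ->
  exists2 theta : K, 0 < theta < 1 & forall (I Q : finType), #|Q| = q ->
    forall S : {set {ffun I -> Q}},
    (\sum_(i : I) biased S i)%:R * #|S|%:R
      <= #|I|%:R / E%:R * #|S|%:R + #|I|%:R * (3 * theta ^+ #|I| * q%:R ^+ #|I|).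
Proof.
move=> q_gt0 E_gt0; have [s [rho [s0 s1 rho0 rho1 le_rho]]] := @bias_parameters K q q_gt0.
have E0 : 0 < E%:R :> K by rewrite ltr0n.
have E1 : 1 <= E%:R :> K by rewrite ler1n.
(* Bernoulli then gives [theta ^+ E >= (1 + rho) / 2 >= rho]. *)
pose theta := 1 - (1 - rho) / (2 * E%:R).
have d0 : 0 < (1 - rho) / (2 * E%:R) by rewrite divr_gt0 ?mulr_gt0 ?subr_gt0.
have dE : (1 - rho) / (2 * E%:R) * E%:R = (1 - rho) / 2.
  by field; rewrite lt0r_neq0.
have d1 : (1 - rho) / (2 * E%:R) <= 1 / 2 by nra.
set d := (1 - rho) / (2 * E%:R) in theta d0 dE d1.
move: d @theta d0 dE d1 => d theta d0 dE d1.
have theta01 : 0 < theta < 1 by rewrite /theta; apply/andP; split; lra.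
have [theta0 theta1] := andP theta01.
have rhoE : rho <= theta ^+ E.
  have bern n : 1 - n%:R * d <= theta ^+ n.
    elim: n => [|n IH]; first by rewrite mul0r subr0 expr0.
    have nd : 0 <= n%:R * d * d by rewrite !mulr_ge0 ?ler0n // ltW.
    rewrite exprS; apply: le_trans (ler_wpM2l (ltW theta0) IH).
    by rewrite -natr1 /theta; lra.
  by apply: le_trans (bern E); rewrite mulrC dE; lra.
exists theta => // I Q cardQ S; pose J := [set i | biased S i].
have -> : (\sum_i biased S i = #|J|)%N.
  by rewrite -sum1_card [RHS]big_mkcond /=; apply: eq_bigr => i _; rewrite inE;
    case: biased.
have [->|/set0Pn[y0 y0S]] := eqVneq S set0.
  by rewrite cards0 !mulr0 add0r !mulr_ge0 ?ler0n ?exprn_ge0 // ltW.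
have tail0 : 0 <= #|I|%:R * (3 * theta ^+ #|I| * q%:R ^+ #|I|) :> K.
  by rewrite !mulr_ge0 ?ler0n ?exprn_ge0 ?ler0n // ltW.
(* At most a fraction [1 / E] of biased coordinates is paid by the first term. Otherwise [rho ^+
   #|J| <= theta ^+ (E * #|J|) <= theta ^+ #|I|] makes [S] so small that the second term
   suffices. *)
have [le_J|lt_J] := leqP (#|J| * E) #|I|.
  apply: (@le_trans _ _ (#|I|%:R / E%:R * #|S|%:R)); last by rewrite lerDl.
  by rewrite ler_wpM2r ?ler0n // ler_pdivlMr // -natrM ler_nat.
have exv i : exists x, (i \in J) ==> (2 * #|Q| * #|fiber S i x| < #|S|)%N.
  by rewrite inE; case: (boolP (biased S i)) => [/existsP[x]|_]; [exists x|exists (y0 i)].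
pose v i := xchoose (exv i).
have rare i : i \in J -> (2 * #|Q| * #|fiber S i (v i)| <= #|S|)%N.
  by move=> iJ; apply: ltnW; have /implyP/(_ iJ) := xchooseP (exv i).
have := few_hits_large rare; rewrite -(ler_nat K) natrM => /le_trans large.
rewrite cardQ in large.
have small := @few_hits_small K I Q J v s rho s0 s1 rho0; rewrite cardQ in small.
have {}small := small le_rho.
apply: (@le_trans _ _ (#|I|%:R * #|S|%:R)).
  by rewrite ler_wpM2r ?ler0n // ler_nat max_card.
rewrite -[leLHS]add0r; apply: lerD; first by rewrite !mulr_ge0 ?ler0n ?invr_ge0 ?ler0n.
rewrite ler_wpM2l ?ler0n // -mulrA; apply: large; rewrite ler_wpM2l ?ler0n //.
apply: le_trans (_ : _ <= #|[set y : {ffun I -> Q} | (4 * q * hits J v y <= 3 *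
  #|J|)%N]|%:R) _.
  by rewrite ler_nat subset_leq_card //; apply/subsetP => y; rewrite !inE => /andP[].
apply: le_trans small _; rewrite mulrC ler_wpM2r ?exprn_ge0 ?ler0n //.
apply: (@le_trans _ _ ((theta ^+ E) ^+ #|J|));
  first by rewrite lerXn2r // nnegrE ?exprn_ge0 // ltW.
by rewrite -exprM; apply: ler_wiXn2l; [exact: ltW|exact: ltW|rewrite mulnC ltnW].
Qed.

(** * The block structure *)

Local Close Scope ring_scope.

(** Perfect matchings are fixed-point-free involutions, on which relabelling acts by conjugation. *)
Definition is_matching (V : finType) (f : V -> V) : bool :=
  [forall v, (f (f v) == v) && (f v != v)].

Lemma matchingP (V : finType) (f : V -> V) :
  reflect (involutive f /\ forall v, f v != v) (is_matching f).
Proof.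
apply: (iffP forallP) => [fP|[fK f_neq] v]; last by rewrite fK eqxx f_neq.
by split=> v; have /andP[/eqP] := fP v.
Qed.

Definition crossing (V : finType) (U : {set V}) (f : V -> V) : nat :=
  #|[set v in U | f v \notin U]|.

Definition relabel (V : finType) (p : {perm V}) (U : {set V}) : {set V} :=
  [set v | (p^-1)%g v \in U].

Section Transport.
Variable V : finType.
Implicit Types (U : {set V}) (p M : {perm V}).

Lemma mem_relabel p U v : (p v \in relabel p U) = (v \in U).
Proof. by rewrite inE permK. Qed.

Lemma relabel_eq p U U' : (forall v, (p v \in U') = (v \in U)) -> relabel p U = U'.
Proof. by move=> h; apply/setP => v; rewrite inE -h permKV. Qed.

Lemma conj_eq p M M' : (forall v, M' (p v) = p (M v)) -> (M ^ p)%g = M'.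
Proof. by move=> h; apply/permP => v; rewrite -(permKV p v) permJ h. Qed.

Lemma relabelM p p' U : relabel (p * p') U = relabel p' (relabel p U).
Proof. by apply/setP => v; rewrite !inE invMg permM. Qed.

Lemma card_relabel p U : #|relabel p U| = #|U|.
Proof.
rewrite -[RHS](card_imset _ (@perm_inj _ p)); apply: eq_card => v.
by rewrite -[v](permKV p) mem_relabel mem_imset //; exact: perm_inj.
Qed.

Lemma crossing_relabel p U M : crossing (relabel p U) (M ^ p)%g = crossing U M.
Proof.
rewrite /crossing -[RHS](card_relabel p); apply: eq_card => v.
by rewrite -[v](permKV p) mem_relabel !inE permJ !permK.
Qed.

Lemma conj_matching p M : is_matching M -> is_matching (M ^ p)%g.
Proof.
move=> /matchingP[MK M_neq]; apply/matchingP; split=> v.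
  by rewrite -(permKV p v) !permJ MK.
by rewrite -(permKV p v) permJ (inj_eq perm_inj).
Qed.

(** The vertices of [U] matched inside [U] are paired up by [M], so they do not affect the
    parity. *)
Lemma odd_crossing U M : is_matching M -> odd (crossing U M) = odd #|U|.
Proof.
move=> /matchingP[MK M_neq]; rewrite -(cardsID [set v in U | M v \notin U] U).
rewrite (setIidPr _); last by apply/subsetP => v; rewrite inE => /andP[].
rewrite oddD -[LHS]addbF; congr addb; symmetry; apply: negbTE.
apply: (involution_card_even MK M_neq) => v; rewrite !inE MK.
by case: (v \in U); rewrite ?andbF //= negbK andbT.
Qed.

End Transport.

(* [bool * core h] is the pair of special k-sets C (tag [false]) and D (tag
   [true]), in which ['I_3] indexes a triple of edges between C and D. It is
   followed by the A-blocks, each contained in or disjoint from a cut, the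
   B-blocks, never met by a cut, and the leftover vertices. In families of blocks
   indexed by [option 'I_m], the index [None] stands for the block obtained from
   C (for cuts), or from C and D (for matchings), by removing the triple. *)
Definition halfblock (h : nat) : finType := (bool * 'I_h)%type.
Definition core (h : nat) : finType := ('I_3 + halfblock h)%type.
Definition vertex (m h l : nat) : finType :=
  (bool * core h + 'I_m * halfblock h + 'I_m * (bool * halfblock h) + 'I_l * bool)%type.

(** A B-block has the shape of C and D without the triple, so the same matchings live on both and
    can be exchanged. *)
Definition block_matching (h : nat) : finType :=
  {f : {ffun bool * halfblock h -> bool * halfblock h} | is_matching f}.

Section Gadget.
Variables (m h l : nat).
Local Notation V := (vertex m h l).
Local Notation Q := (block_matching h).
Implicit Types (x : {ffun option 'I_m -> bool}) (y : {ffun option 'I_m -> Q}).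
Implicit Types (o : option 'I_m).

Definition vK c (j : core h) : V := inl (inl (inl (c, j))).
Definition vA i (w : halfblock h) : V := inl (inl (inr (i, w))).
Definition vB i (z : bool * halfblock h) : V := inl (inr (i, z)).
Definition vL i (c : bool) : V := inr (i, c).

Definition flip (w : halfblock h) : halfblock h := (~~ w.1, w.2).

(** Only the triple and the block [y None] can cross a gadget cut: A-blocks are matched internally,
    and cuts avoid the B-blocks and the leftover vertices. *)
Definition mat_fun y (v : V) : V :=
  match v with
  | inl (inl (inl (c, inl j))) => vK (~~ c) (inl j)
  | inl (inl (inl (c, inr w))) =>
      let z := val (y None) (c, w) in vK z.1 (inr z.2)
  | inl (inl (inr (i, w))) => vA i (flip w)
  | inl (inr (i, z)) => vB i (val (y (Some i)) z)
  | inr (i, c) => vL i (~~ c)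
  end.

Lemma flipK : involutive flip.
Proof. by case=> c i; rewrite /flip /= negbK. Qed.

Lemma flip_neq w : flip w != w.
Proof. by case: w => [[] i]; rewrite xpair_eqE. Qed.

Lemma block_matchingP (f : Q) : involutive (val f) /\ forall z, val f z != z.
Proof. exact/matchingP/(valP f). Qed.

Lemma mat_funK y : involutive (mat_fun y).
Proof.
case=> [[[[c [j|w]]|[i w]]|[i z]]|[i c]] //=; rewrite ?negbK ?flipK //.
  by rewrite -surjective_pairing (block_matchingP _).1.
by rewrite (block_matchingP _).1.
Qed.

Definition gadget_mat y : {perm V} := perm (can_inj (mat_funK y)).

Lemma mat_matching y : is_matching (gadget_mat y).
Proof.
apply/matchingP; split=> v; rewrite !permE ?mat_funK //.
case: v => [[[[c [j|w]]|[i w]]|[i z]]|[i c]] //=.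
- by apply/eqP => -[]; case: c.
- have := (block_matchingP (y None)).2 (c, w); case: (val (y None) (c, w)) => c' w' /=.
  by apply: contra => /eqP[-> ->].
- by have := flip_neq w; apply: contra => /eqP[->].
- by have := (block_matchingP (y (Some i))).2 z; apply: contra => /eqP[->].
- by apply/eqP => -[]; case: c.
Qed.

Definition mem_cut x (v : V) : bool :=
  match v with
  | inl (inl (inl (c, inl _))) => ~~ c
  | inl (inl (inl (c, inr _))) => ~~ c && x None
  | inl (inl (inr (i, _))) => x (Some i)
  | _ => false
  end.

Definition gadget_cut x : {set V} := [set v | mem_cut x v].

Lemma crossing_cut x y : crossing (gadget_cut x) (gadget_mat y)
  = #|[set j : core h | if j is inr w then x None && (val (y None) (false,
    w)).1 else true]|.
Proof.
set A := [set j | _].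
have vK_inj : injective (vK false) by move=> j j' [].
rewrite -(card_imset _ vK_inj) /crossing; apply: eq_card => v.
apply/idP/imsetP => [|[j jA ->]]; last first.
  move: jA; rewrite !inE permE; case: j => [j|w] //= /andP[-> ].
  by case: (val (y None) _) => -[] z.
rewrite !inE permE; case: v => [[[[c [j|w]]|[i w]]|[i z]]|[i c]] //=.
- by case: c => //= _; exists (inl j); rewrite ?inE.
- case: c => //=; case xN : (x None) => //=; rewrite andbT negbK => zT.
  by exists (inr w); rewrite ?inE ?xN.
- by case: (x _).
Qed.

Definition std_triple : {set core h} := [set inl j | j : 'I_3].

Lemma mem_std (j : core h) : (j \in std_triple) = if j is inl _ then true else false.
Proof.
case: j => [j|w]; first by apply/imsetP; exists j.
by apply/imsetP => -[].
Qed.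

Lemma card_std : #|std_triple| = 3.
Proof. by rewrite card_imset ?card_ord // => i j []. Qed.

Lemma card_core : #|{: core h}| = 3 + 2 * h.
Proof. by rewrite card_sum card_prod card_bool !card_ord. Qed.

Lemma block_across_subproof :
  is_matching [ffun z : bool * halfblock h => (~~ z.1, z.2)].
Proof.
by apply/matchingP; split=> -[[] w]; rewrite !ffunE ?xpair_eqE.
Qed.
Definition block_across : Q :=
  exist (fun f : {ffun bool * halfblock h -> bool * halfblock h} => is_matching f) _
    block_across_subproof.

Lemma block_acrossE z : val block_across z = (~~ z.1, z.2).
Proof. by rewrite ffunE. Qed.

Lemma block_within_subproof :
  is_matching [ffun z : bool * halfblock h => (z.1, flip z.2)].
Proof.
apply/matchingP; split=> -[c w]; rewrite !ffunE /= ?flipK //.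
by rewrite xpair_eqE eqxx flip_neq.
Qed.
(** Each half carries the matching [flip] of an A-block, so the C half can trade places with an
    A-block without changing the matching. *)
Definition block_within : Q :=
  exist (fun f : {ffun bool * halfblock h -> bool * halfblock h} => is_matching f) _
    block_within_subproof.

Lemma block_withinE z : val block_within z = (z.1, flip z.2).
Proof. by rewrite ffunE. Qed.

(** Conjugate [block_within] by the transposition of [v] with the partner of [u]. *)
Lemma block_matching_join (u v : halfblock h) : u != v ->
  exists f : Q, val f (false, u) = (false, v).
Proof.
move=> neq_uv.
pose t := tperm (false, v) (false, flip u).
have tK : involutive t by move=> z; rewrite tpermK.
have tf : is_matching [ffun z => t (val block_within (t z))].
  move: (val block_within) (block_matchingP block_within) => g [gK g_neq].
  apply/matchingP; split=> z; rewrite !ffunE ?(tK, gK) //.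
  by apply: contra (g_neq (t z)) => /eqP {2}<-; rewrite tK.
exists (exist (fun f : {ffun bool * halfblock h -> bool * halfblock h} =>
  is_matching f) _ tf).
rewrite /= ffunE.
rewrite [t (false, u)]tpermD ?xpair_eqE ?[v == u]eq_sym //=; last by rewrite flip_neq.
by rewrite block_withinE tpermR.
Qed.

Lemma crossing3_notin x y : ~~ x None -> crossing (gadget_cut x) (gadget_mat y) = 3.
Proof.
move=> xN; rewrite crossing_cut -[RHS]card_std; apply: eq_card => j.
by rewrite mem_std inE (negPf xN); case: j.
Qed.

Lemma crossing3_within x y : y None =
  block_within -> crossing (gadget_cut x) (gadget_mat y) = 3.
Proof.
move=> yN; rewrite crossing_cut -[RHS]card_std; apply: eq_card => j.
by rewrite mem_std inE yN; case: j => // w; rewrite block_withinE andbF.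
Qed.

Lemma crossing_across x y : x None -> y None = block_across ->
  crossing (gadget_cut x) (gadget_mat y) = 3 + 2 * h.
Proof.
move=> xN yN; rewrite crossing_cut -[RHS]card_core; apply: eq_card => j.
by rewrite !inE yN; case: j => // w; rewrite block_acrossE xN.
Qed.

(** By parity, since [block_within] gives a matching that crosses any gadget cut 3 times. *)
Lemma odd_cut x : odd #|gadget_cut x|.
Proof.
pose y : {ffun option 'I_m -> Q} := [ffun => block_within].
by rewrite -(odd_crossing _ (mat_matching y)) crossing3_within // ffunE.
Qed.

Definition exchange (S : Type) (z : {ffun option 'I_m -> S}) o : {ffun option 'I_m ->
  S} :=
  [ffun a => z (tperm None o a)].

(** C and D without the triple trade places with B-block [i], which realises [exchange] on
    matchings; [None] gives the identity. A cut is unaffected when it avoids C outside the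
    triple. *)
Definition swapB_fun o (v : V) : V :=
  match o, v with
  | Some i, inl (inl (inl (c, inr w))) => vB i (c, w)
  | Some i, inl (inr (i', z)) => if i' == i then vK z.1 (inr z.2) else v
  | _, _ => v
  end.

Lemma exchangeE (S : Type) (z : {ffun option 'I_m -> S}) o a :
  exchange z o a = z (tperm None o a).
Proof. by rewrite ffunE. Qed.

Lemma swapB_funK o : involutive (swapB_fun o).
Proof.
case: o => [i|] [[[[c [j|w]]|[i' w]]|[i' [c w]]]|[i' c]] //=; first by rewrite eqxx.
by case: (i' =P i) => [->|] //= /eqP/negPf ->.
Qed.

Definition swapB o : {perm V} := perm (can_inj (swapB_funK o)).

Lemma mat_swapB y o : (gadget_mat y ^ swapB o)%g = gadget_mat (exchange y o).
Proof.
apply: conj_eq => v; rewrite !permE.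
case: o => [i|]; case: v => [[[[c [j|w]]|[i' w]]|[i' [c w]]]|[i' c]] //=;
  rewrite ?exchangeE ?tperm1 ?perm1 ?tpermL ?tpermR //=.
- by case: (val (y None) (c, w)).
- have [->|neq] := eqVneq i' i; rewrite /= exchangeE ?tpermL //.
  have -> // : tperm None (Some i) (Some i') = Some i'.
    by apply: tpermD => //; rewrite eq_sym.
Qed.

Lemma cut_swapB x o : ~~ x None -> relabel (swapB o) (gadget_cut x) = gadget_cut x.
Proof.
move=> /negPf xN; apply: relabel_eq => v; rewrite !inE permE.
case: o => [i|] //; case: v => [[[[c [j|w]]|[i' w]]|[i' [c w]]]|[i' c]] //=;
  rewrite ?xN ?andbF //.
by case: eqP; rewrite //= ?xN ?andbF.
Qed.

(** Here only the C half moves, in exchange for an A-block: this realises [exchange] on cuts. *)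
Definition swapA_fun o (v : V) : V :=
  match o, v with
  | Some i, inl (inl (inl (false, inr w))) => vA i w
  | Some i, inl (inl (inr (i', w))) => if i' == i then vK false (inr w) else v
  | _, _ => v
  end.

Lemma swapA_funK o : involutive (swapA_fun o).
Proof.
case: o => [i|] [[[[[] [j|w]]|[i' w]]|[i' [c w]]]|[i' c]] //=; first by rewrite eqxx.
by case: (i' =P i) => [->|] //= /eqP/negPf ->.
Qed.

Definition swapA o : {perm V} := perm (can_inj (swapA_funK o)).

Lemma mat_swapA y o : y None = block_within -> (gadget_mat y ^ swapA o)%g = gadget_mat y.
Proof.
move=> yN; apply: conj_eq => v; rewrite !permE.
case: o => [i|] //; case: v => [[[[[] [j|w]]|[i' w]]|[i' [c w]]]|[i' c]] //=;
  rewrite ?yN ?block_withinE //=.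
by case: eqP; rewrite //= yN block_withinE.
Qed.

Lemma cut_swapA x o : relabel (swapA o) (gadget_cut x) = gadget_cut (exchange x o).
Proof.
apply: relabel_eq => v; rewrite !inE permE.
case: o => [i|]; case: v => [[[[[] [j|w]]|[i' w]]|[i' [c w]]]|[i' c]] //=;
  rewrite ?exchangeE ?tperm1 ?perm1 ?tpermL ?tpermR //=.
have [->|neq] := eqVneq i' i; rewrite /= exchangeE ?tpermL ?tpermR //.
have -> // : tperm None (Some i) (Some i') = Some i'.
    by apply: tpermD => //; rewrite eq_sym.
Qed.

(** Acting alike on C and D preserves the matching of equal indices and the cut containing all of C,
    while it moves the triple. *)
Definition core_fun (s : {perm core h}) (v : V) : V :=
  if v is inl (inl (inl (c, j))) then vK c (s j) else v.

Lemma core_fun_inj s : injective (core_fun s).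
Proof.
by apply: (@can_inj _ _ _ (core_fun s^-1)); case=> [[[[c j]|[i w]]|[i z]]|[i c]] //=;
  rewrite permK.
Qed.

Definition core_perm s : {perm V} := perm (@core_fun_inj s).

Lemma core_permM s t : core_perm (s * t) = (core_perm s * core_perm t)%g.
Proof.
by apply/permP => -[[[[c j]|[i w]]|[i z]]|[i c]]; rewrite permM !permE //= permM.
Qed.

Lemma mat_core y s : y None = block_across -> (gadget_mat y ^ core_perm s)%g =
  gadget_mat y.
Proof.
move=> yN.
have matK c j : mat_fun y (vK c j) = vK (~~ c) j.
  by case: j => [j|w] //=; rewrite yN block_acrossE.
apply: conj_eq => v; rewrite !permE.
by case: v => [[[[c j]|[i' w]]|[i' [c w]]]|[i' c]] //; rewrite !matK.
Qed.

Lemma cut_core x s : x None -> relabel (core_perm s) (gadget_cut x) = gadget_cut x.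
Proof.
move=> xN; have cutK c j : mem_cut x (vK c j) = ~~ c.
  by case: j => [j|w] //=; rewrite xN andbT.
apply: relabel_eq => v; rewrite !inE !permE.
by case: v => [[[[c j]|[i' w]]|[i' [c w]]]|[i' c]] //; rewrite !cutK.
Qed.

(* If the triples [s @: std_triple] and [std_triple] share only the edge [e], a
   matching that joins the other two C-endpoints of the first triple crosses the
   cut of that triple in [e] alone. *)
Lemma crossing1 (s : {perm core h}) : #|[set s j | j in std_triple] :&: std_triple| = 1 ->
  exists f : Q, forall x y, ~~ x None -> y None = f ->
    crossing (relabel (core_perm s) (gadget_cut x)) (gadget_mat y) = 1.
Proof.
move=> card1; set H := [set s j | j in std_triple].
have cardH : #|H| = 3 by rewrite card_imset ?card_std //; exact: perm_inj.
have /cards1P[e He] : #|H :&: std_triple| == 1 by rewrite card1.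
have /cards2P[u' [v' [neq_uv Huv]]] : #|H :\: std_triple| == 2 by rewrite cardsD cardH
  card1.
have : u' \in H :\: std_triple by rewrite Huv !inE eqxx.
rewrite inE mem_std; case: u' => // u in neq_uv Huv *; move=> /andP[_ uH].
have : v' \in H :\: std_triple by rewrite Huv !inE eqxx orbT.
rewrite inE mem_std; case: v' => // v in neq_uv Huv *; move=> /andP[_ vH].
have neq : u != v by apply: contra neq_uv => /eqP ->.
have [f fuv] := block_matching_join neq.
exists f => x y /negPf xN yN.
have memK c j : (vK c j \in relabel (core_perm s) (gadget_cut x)) = ~~ c && (j \in H).
  have -> : vK c j = core_perm s (vK c ((s^-1)%g j)) by rewrite permE /= permKV.
  rewrite mem_relabel inE /= -[j in RHS](permKV s) mem_imset; last exact: perm_inj.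
  by rewrite mem_std; case: ((s^-1)%g j) => [i|w] /=; rewrite ?andbT ?xN.
have memO w : (if w is inl (inl (inl _)) then false else true) ->
    (w \in relabel (core_perm s) (gadget_cut x)) = (w \in gadget_cut x).
  move=> nK; have {1}-> : w = core_perm s w by rewrite permE; case: w nK => [[[]|]|].
  exact: mem_relabel.
have -> : 1 = #|[set vK false e]| by rewrite cards1.
apply: eq_card => w; rewrite inE in_set1 permE.
have eH : e \in H /\ e \in std_triple by apply/andP; rewrite -in_setI He set11.
case: w => [[[[c j]|[i w]]|[i z]]|[i c]].
- rewrite -/(vK c j) memK.
  have -> : (vK c j == vK false e) = ~~ c && (j == e) by case: c; rewrite ?andbF.
  case: c => //=; case: j => [j|w].
    rewrite memK /= andbT.
    have : (inl j \in H :&: std_triple) = (inl j == e) by rewrite He inE.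
    by rewrite inE mem_std andbT.
  have -> : (inr w == e) = false by case: eqP eH => // <-; rewrite mem_std; case.
  apply/negbTE; rewrite negb_and negbK /= yN memK.
  case wH : (inr w \in H) => //=.
  have : (inr w : core h) \in H :\: std_triple by rewrite inE wH mem_std.
  rewrite Huv !inE => /orP[]/eqP[->]; first by rewrite fuv.
  by rewrite -fuv (block_matchingP f).1.
- by rewrite /= !memO // !inE /= andbN.
- by rewrite /= !memO // !inE.
- by rewrite /= !memO // !inE.
Qed.

Lemma card_vertex : #|{: V}| = 2 * (3 + 2 * h + m * h + m * (2 * h) + l).
Proof.
rewrite !card_sum !card_prod ?card_core ?card_prod ?card_bool ?card_ord.
lia.
Qed.

End Gadget.

(** * The rectangle inequality *)

Local Open Scope ring_scope.

Section Exchange.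
Variables (K : realFieldType) (m E : nat) (G : finGroupType) (Q : finType).
Variables (theta : K) (S : G -> {set {ffun option 'I_m -> Q}}).
Variables (tau : option 'I_m -> G) (c : G -> K).
Hypothesis few : forall A : {set {ffun option 'I_m -> Q}},
  (\sum_o biased A o)%:R * #|A|%:R
    <= m.+1%:R / E%:R * #|A|%:R + m.+1%:R * (3 * theta ^+ m.+1 * #|Q|%:R ^+ m.+1).
Hypothesis S_tau : forall g o y, (y \in S (tau o * g)%g) = (exchange y o \in S g).
Hypothesis c_tau : forall g o, c (tau o * g)%g = c g.
Hypothesis c_ge0 : forall g, 0 <= c g.

Lemma exchangeK o : involutive (fun y : {ffun option 'I_m -> Q} => exchange y o).
Proof. by move=> y; apply/ffunP => a; rewrite !exchangeE tpermK. Qed.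

Lemma card_exchange o (A : {set {ffun option 'I_m -> Q}}) :
  #|[set y | exchange y o \in A]| = #|A|.
Proof.
rewrite -[RHS](card_imset _ (can_inj (exchangeK o))); apply: eq_card => y.
rewrite inE; apply/idP/imsetP => [yA|[z zA ->]]; last by rewrite exchangeK.
by exists (exchange y o); rewrite ?exchangeK.
Qed.

Lemma card_S_tau g o : #|S (tau o * g)%g| = #|S g|.
Proof. by rewrite -(card_exchange o (S g)); apply: eq_card => y; rewrite S_tau inE. Qed.

Lemma biased_S_tau g o : biased (S (tau o * g)%g) None = biased (S g) o.
Proof.
rewrite /biased card_S_tau; apply: eq_existsb => v; congr (_ * _ < _)%N.
rewrite -(card_exchange o (fiber (S g) o v)); apply: eq_card => y.
by rewrite !inE S_tau exchangeE tpermR.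
Qed.

(* The coordinate [None] is exchangeable with every other one, so it is biased
   with the average frequency of biased coordinates. *)
Lemma exchange_bound :
  \sum_g (biased (S g) None)%:R * (#|S g|%:R * c g)
   <= E%:R^-1 * (\sum_g #|S g|%:R * c g)
      + 3 * theta ^+ m.+1 * #|Q|%:R ^+ m.+1 * \sum_g c g.
Proof.
have m0 : 0 < m.+1%:R :> K by rewrite ltr0n.
have avg : m.+1%:R * (\sum_g (biased (S g) None)%:R * (#|S g|%:R * c g))
    = \sum_g (\sum_o biased (S g) o)%:R * #|S g|%:R * c g.
  under [RHS]eq_bigr do rewrite -mulrA natr_sum mulr_suml.
  rewrite exchange_big /= (_ : m.+1 = #|{: option 'I_m}|);
    last by rewrite card_option card_ord.
  rewrite mulr_natl -sumr_const; apply: eq_bigr => o _.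
  rewrite (reindex_inj (mulgI (tau o))); apply: eq_bigr => g _ /=.
  by rewrite biased_S_tau card_S_tau c_tau.
rewrite -(ler_pM2l m0) avg mulrDr !mulr_sumr -big_split /=.
apply: ler_sum => g _.
apply: le_trans (ler_wpM2r (c_ge0 g) (few (S g))) _.
by rewrite mulrDl; lra.
Qed.

End Exchange.

Lemma card_ffun_at (S : finType) (m : nat) (v : S) :
  #|[set y : {ffun option 'I_m -> S} | y None == v]| = (#|S| ^ m)%N.
Proof.
rewrite -sum1_card big_mkcond /=.
rewrite (eq_bigr (fun y : {ffun option 'I_m -> S} =>
    \prod_o (if o is None then (y o == v : nat) else 1)%N)); last first.
  move=> y _; rewrite inE (bigD1 None) //= big1 ?muln1; first by case: eqP.
  by case.
rewrite -(bigA_distr_bigA (fun o x => if o is None then (x == v : nat) else 1%N)).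
rewrite (bigD1 None) //= (bigD1 v) //= eqxx big1 => [|x /negPf -> //].
rewrite addn0 mul1n (eq_bigr (fun=> #|S|)) => [|[i|] // _]; last by rewrite sum1_card.
by rewrite prod_nat_const cardC1 card_option card_ord.
Qed.

Lemma card_ffun_option (S : finType) (m : nat) :
  #|{: {ffun option 'I_m -> S}}| = (#|S| ^ m.+1)%N.
Proof. by rewrite card_ffun card_option card_ord. Qed.

Section Rectangle.
Variables (K : realFieldType) (m h l E : nat) (theta : K).
Local Notation V := (vertex m h l).
Local Notation Q := (block_matching h).
Local Notation q := #|{: Q}|.
Local Notation k := (3 + 2 * h)%N.
Variables (P : pred {set V}) (R : pred {perm V}).
Hypothesis fewQ : forall A : {set {ffun option 'I_m -> Q}},
  (\sum_o biased A o)%:R * #|A|%:R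
    <= m.+1%:R / E%:R * #|A|%:R + m.+1%:R * (3 * theta ^+ m.+1 * q%:R ^+ m.+1).
Hypothesis few2 : forall A : {set {ffun option 'I_m -> bool}},
  (\sum_o biased A o)%:R * #|A|%:R
    <= m.+1%:R / E%:R * #|A|%:R + m.+1%:R * (3 * theta ^+ m.+1 * #|{: bool}|%:R ^+ m.+1).
Hypothesis not1 : forall (U : {set V}) (M : {perm V}),
  odd #|U| -> is_matching M -> P U -> R M ->
  crossing U M != 1%N.
Hypothesis theta0 : 0 <= theta.

Implicit Types (x : {ffun option 'I_m -> bool}) (y : {ffun option 'I_m -> Q}).

Definition cuts (p : {perm V}) : {set {ffun option 'I_m -> bool}} :=
  [set x | P (relabel p (gadget_cut h l x))].
Definition mats (p : {perm V}) : {set {ffun option 'I_m -> Q}} :=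
  [set y | R (gadget_mat l y ^ p)%g].

Definition cuts_at p b : nat := #|fiber (cuts p) None b|.
Definition mats_at p f : nat := #|fiber (mats p) None f|.

(** The relabellings at which recombination works: there is a cut with only the triple in C, and
    every block matching occurs at [None]. *)
Definition good p : bool :=
  [&& ~~ biased (cuts p) None, ~~ biased (mats p) None,
      (0 < cuts_at p false)%N & (0 < #|mats p|)%N].

(** Take a cut with [x None] false from [s2] and, from [s1], a matching with the block matching of
    [crossing1]. Both lie in the rectangle and they cross once, against [not1]. *)
Lemma good_meet p s1 s2 : good (core_perm m l s1 * p)%g -> good (core_perm m l s2 *
  p)%g ->
  #|[set s1 j | j in std_triple h] :&: [set s2 j | j in std_triple h]| != 1%N.
Proof.
move=> /and4P[_ nb _ M0] /and4P[_ _ a0 _]; apply/negP => /eqP card1.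
have card1' : #|[set (s2 * s1^-1)%g j | j in std_triple h] :&: std_triple h| = 1%N.
  rewrite -card1 -[RHS](card_imset _ (@perm_inj _ (s1^-1)%g)); apply: eq_card => j.
  rewrite -[j](permK s1) mem_imset; last exact: perm_inj.
  rewrite !inE andbC; congr (_ && _); first by rewrite mem_imset ?permK //;
    exact: perm_inj.
  by rewrite -[s1 j](permKV s2) -[in LHS](permK s2 ((s2^-1)%g (s1 j))) permKV -permM
    !mem_imset //; exact: perm_inj.
have [f f1] := crossing1 m l card1'.
have {}nb : (#|mats (core_perm m l s1 * p)%g| <= 2 * q * mats_at (core_perm m l s1 *
  p)%g f)%N.
  by rewrite leqNgt; apply: contra nb => lt; apply/existsP; exists f.
have /card_gt0P[y] : (0 < mats_at (core_perm m l s1 * p)%g f)%N.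
  by case: (mats_at _ _) nb => //; rewrite muln0 leqNgt M0.
rewrite !inE => /andP[Ry /eqP yf].
move/card_gt0P: a0 => [x]; rewrite !inE => /andP[Px /eqP xN].
have := not1 _ _ Px Ry; rewrite card_relabel odd_cut conj_matching ?mat_matching //.
have -> : (core_perm m l s2 = core_perm m l (s2 * s1^-1) * core_perm m l s1)%g.
  by rewrite -core_permM mulgKV.
rewrite conjgM !relabelM crossing_relabel crossing_relabel.
by rewrite f1 // ?xN // => /(_ isT isT).
Qed.

Lemma card_good_triples p (sH : {set core h} -> {perm core h}) :
  (forall H : {set core h}, #|H| = 3 -> [set sH H j | j in std_triple h] = H) ->
  (#|[set H : {set core h} | (#|H| == 3) && good (core_perm m l (sH H) * p)%g]| <= 4 *
    k)%N.
Proof.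
move=> sHP; rewrite -(card_core h); apply: triple_family_bound.
  by move=> H; rewrite inE => /andP[/eqP].
move=> H1 H2; rewrite !inE => /andP[/eqP c1 g1] /andP[/eqP c2 g2].
by have := good_meet g1 g2; rewrite !sHP.
Qed.

(** Reindexing by a core permutation that carries the standard triple to a given one leaves the
    total of [c] unchanged. So the 'C(k, 3) copies of the sum can be distributed over all triples,
    of which at most [4 k] are good at a fixed [p]. *)
Lemma sum_good (c : {perm V} -> K) :
  (forall p, 0 <= c p) -> (forall s p, c (core_perm m l s * p)%g = c p) ->
  'C(k, 3)%:R * (\sum_p (good p)%:R * c p) <= (4 * k)%:R * \sum_p c p.
Proof.
move=> c0 c_core.
have exs (H : {set core h}) : exists s : {perm core h},
    (#|H| == 3) ==> ([set s j | j in std_triple h] == H).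
  case: (#|H| =P 3) => [cH|_]; last by exists 1%g.
  have [|s <-] := @perm_imset_exists _ (std_triple h) H; first by rewrite card_std cH.
  by exists s; rewrite eqxx.
pose sH H := xchoose (exs H).
have sHP (H : {set core h}) : #|H| = 3 -> [set sH H j | j in std_triple h] = H.
  by move=> cH; apply/eqP/(implyP (xchooseP (exs H)))/eqP.
rewrite -(card_core h) -card_draws mulr_natl -sumr_const.
rewrite (eq_bigr (fun H => \sum_p (good (core_perm m l (sH H) * p)%g)%:R * c p));
  last first.
  move=> H _; rewrite (reindex_inj (mulgI (core_perm m l (sH H)))) /=.
  by apply: eq_bigr => p _; rewrite c_core.
rewrite exchange_big /= mulr_sumr; apply: ler_sum => p _.
rewrite -mulr_suml ler_wpM2r // -natr_sum ler_nat card_core.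
apply: leq_trans (card_good_triples p sHP); rewrite -sum1_card.
rewrite [leqRHS](eq_bigl (fun H : {set core h} =>
  (H \in [set A : {set core h} | #|A| == 3]) && good (core_perm m l (sH H) * p)%g)).
  by rewrite [leqRHS]big_mkcondr.
by move=> H; rewrite !inE.
Qed.

Lemma cuts_swapB p o x : ~~ x None -> (x \in cuts (swapB h l o * p)%g) = (x \in cuts p).
Proof. by move=> xN; rewrite !inE relabelM cut_swapB. Qed.

Lemma mats_swapB p o y : (y \in mats (swapB h l o * p)%g) = (exchange y o \in mats p).
Proof. by rewrite !inE conjgM mat_swapB. Qed.

Lemma cuts_swapA p o x : (x \in cuts (swapA h l o * p)%g) = (exchange x o \in cuts p).
Proof. by rewrite !inE relabelM cut_swapA. Qed.

Lemma mats_swapA p o : mats_at (swapA h l o * p)%g (block_within h) =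
  mats_at p (block_within h).
Proof.
apply: eq_card => y; rewrite !inE.
by case: eqP; rewrite ?andbF ?andbT // => yN; rewrite conjgM mat_swapA.
Qed.

Lemma cuts_core p s : cuts_at (core_perm m l s * p)%g true = cuts_at p true.
Proof.
apply: eq_card => x; rewrite !inE.
by case: eqP; rewrite ?andbF ?andbT // => xN; rewrite relabelM cut_core // xN.
Qed.

Lemma mats_core p s : mats_at (core_perm m l s * p)%g (block_across h) =
  mats_at p (block_across h).
Proof.
apply: eq_card => y; rewrite !inE.
by case: eqP; rewrite ?andbF ?andbT // => yN; rewrite conjgM mat_core.
Qed.

(* The masses of the rectangle for three distributions, supported on pairs with 3,
   3 and k crossings; the second one is invariant under exchanges of A-blocks. *)
Definition weight3 : K := \sum_p (cuts_at p false)%:R * #|mats p|%:R.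
Definition weight3' : K := \sum_p #|cuts p|%:R * (mats_at p (block_within h))%:R.
Definition weightk : K := \sum_p (cuts_at p true)%:R * (mats_at p (block_across h))%:R.

(** If the matchings are biased, the first term suffices. If only the cuts are, [#|mats p|] is at
    most [2 q] times its part with [block_within], which moves the mass to the distribution of
    [weight3']. If neither is, the left side vanishes or [p] is good, and passing to the values with
    k crossings costs [2 * 2] for the cuts and [2 q] for the matchings. *)
Lemma good_pointwise p :
  (cuts_at p false)%:R * #|mats p|%:R <=
    (biased (mats p) None)%:R * (#|mats p|%:R * (cuts_at p false)%:R)
    + 2 * q%:R * ((biased (cuts p) None)%:R
                  * (#|cuts p|%:R * (mats_at p (block_within h))%:R))
    + 8 * q%:R * ((good p)%:R
                  * ((cuts_at p true)%:R * (mats_at p (block_across h))%:R)) :> K.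
Proof.
have cuts_le : (cuts_at p false <= #|cuts p|)%N.
  by apply/subset_leq_card/subsetP => x; rewrite inE => /andP[].
case nbM : (biased (mats p) None).
  rewrite mul1r [#|mats p|%:R * _]mulrC -addrA lerDl.
  by rewrite !(addr_ge0, mulr_ge0) ?ler0n.
have ubM f : (#|mats p| <= 2 * q * mats_at p f)%N.
  by rewrite leqNgt; apply/negP => lt; move/existsP: nbM; apply; exists f.
rewrite mul0r add0r; case nbU : (biased (cuts p) None).
  apply: (@le_trans _ _ (2 * q%:R * (#|cuts p|%:R * (mats_at p (block_within h))%:R))).
    by rewrite -!natrM ler_nat mulnCA leq_mul.
  by rewrite mul1r lerDl !mulr_ge0 ?ler0n.
rewrite mul0r mulr0 add0r.
have ubU v : (#|cuts p| <= 2 * 2 * cuts_at p v)%N.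
  rewrite leqNgt; apply/negP => lt; move/existsP: nbU; apply; exists v.
  by rewrite card_bool.
rewrite /good nbM nbU /=; have [->|a0] := posnP (cuts_at p false);
  first by rewrite !mul0r mulr0.
have [->|w0] := posnP #|mats p|; first by rewrite mulr0 mul0r mulr0.
rewrite mul1r -!natrM ler_nat.
apply: leq_trans (_ : 2 * 2 * cuts_at p true * (2 * q * mats_at p (block_across h)) <=
  _)%N.
  by rewrite leq_mul // (leq_trans cuts_le).
by apply: eq_leq; ring.
Qed.

(** Sum [good_pointwise] over [p]. Exchanges of B-blocks control the term with biased matchings,
    exchanges of A-blocks the term with biased cuts, and [sum_good] the last one. In the error
    terms, the exponent is [m] instead of [m.+1] on the side whose coordinate [None] is fixed. *)
Lemma rectangle_bound : 'C(k, 3)%:R * weight3 <= 'C(k, 3)%:R * (E%:R^-1 * weight3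
    + 3 * theta ^+ m.+1 * (#|{perm V}|%:R * 2 ^+ m * q%:R ^+ m.+1)
    + 2 * q%:R * (E%:R^-1 * weight3'
        + 3 * theta ^+ m.+1 * (#|{perm V}|%:R * 2 ^+ m.+1 * q%:R ^+ m)))
    + 8 * q%:R * ((4 * k)%:R * weightk).
Proof.
have t0 : 0 <= 3 * theta ^+ m.+1 by rewrite mulr_ge0 // exprn_ge0.
have bM : \sum_p (biased (mats p) None)%:R * (#|mats p|%:R * (cuts_at p false)%:R)
    <= E%:R^-1 * weight3
       + 3 * theta ^+ m.+1 * (#|{perm V}|%:R * 2 ^+ m * q%:R ^+ m.+1).
  have cB p o : (cuts_at (swapB h l o * p)%g false)%:R = (cuts_at p false)%:R :> K.
    congr (_%:R); apply: eq_card => x; rewrite inE [RHS]inE.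
    by case: eqP; rewrite ?andbF ?andbT // => xN; rewrite cuts_swapB // xN.
  have := exchange_bound fewQ mats_swapB cB (fun p => ler0n K _).
  move/le_trans; apply; rewrite lerD //.
    by rewrite /weight3 ler_wpM2l ?invr_ge0 ?ler0n //; apply: ler_sum => p _;
      rewrite mulrC.
  rewrite -!mulrA !(ler_wpM2l, ler0n, exprn_ge0) //.
  rewrite mulrC !mulrA ler_wpM2r ?exprn_ge0 ?ler0n //.
  rewrite mulr_natl -sumr_const; apply: ler_sum => p _.
  rewrite -natrX ler_nat -card_bool -(card_ffun_at _ false).
  by apply/subset_leq_card/subsetP => x; rewrite !inE => /andP[].
have bU : \sum_p (biased (cuts p) None)%:R * (#|cuts p|%:R *
  (mats_at p (block_within h))%:R)
    <= E%:R^-1 * weight3'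
       + 3 * theta ^+ m.+1 * (#|{perm V}|%:R * 2 ^+ m.+1 * q%:R ^+ m).
  have cA p o : (mats_at (swapA h l o * p)%g (block_within h))%:R =
    (mats_at p (block_within h))%:R :> K.
    by rewrite mats_swapA.
  have := exchange_bound few2 cuts_swapA cA (fun p => ler0n K _).
  move/le_trans; apply; rewrite lerD // card_bool -!mulrA !(ler_wpM2l, ler0n,
    exprn_ge0) //.
  rewrite mulrCA ler_wpM2l ?exprn_ge0 ?ler0n //.
  rewrite mulr_natl -sumr_const; apply: ler_sum => p _.
  rewrite -natrX ler_nat -(card_ffun_at _ (block_within h)).
  by apply/subset_leq_card/subsetP => x; rewrite !inE => /andP[].
have bG : 'C(k, 3)%:R * (\sum_p (good p)%:R
      * ((cuts_at p true)%:R * (mats_at p (block_across h))%:R))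
    <= (4 * k)%:R * weightk.
  apply: sum_good => [p|s p]; first by rewrite mulr_ge0 ?ler0n.
  by rewrite cuts_core mats_core.
have le3 : weight3 <= \sum_p (biased (mats p) None)%:R * (#|mats p|%:R *
  (cuts_at p false)%:R)
    + 2 * q%:R * (\sum_p (biased (cuts p) None)%:R
                  * (#|cuts p|%:R * (mats_at p (block_within h))%:R))
    + 8 * q%:R * (\sum_p (good p)%:R
                  * ((cuts_at p true)%:R * (mats_at p (block_across h))%:R)).
  rewrite !mulr_sumr -!big_split /=; apply: ler_sum => p _; exact: good_pointwise.
apply: le_trans (ler_wpM2l (ler0n K _) le3) _.
rewrite mulrDr lerD //; last by rewrite mulrCA ler_wpM2l // mulr_ge0 ?ler0n.
by rewrite ler_wpM2l ?ler0n // lerD // ler_wpM2l // mulr_ge0 ?ler0n.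
Qed.

End Rectangle.

(** * Covers of the slack by rectangles *)

(** Double counting: every pair lies in exactly [c] rectangles, where [c] will be the slack 2 or k -
    1. *)
Lemma sum_rectangles (J T X Y : finType) (A : {set X}) (B : {set Y})
    (a : J -> T -> pred X) (b : J -> T -> pred Y) (c : nat) :
  (forall t x y, x \in A -> y \in B -> (\sum_j (a j t x && b j t y) = c)%N) ->
  (\sum_j \sum_t #|[set x in A | a j t x]| * #|[set y in B | b j t y]|
     = #|T| * (#|A| * (#|B| * c)))%N.
Proof.
move=> sumc; rewrite exchange_big /= -sum_nat_const; apply: eq_bigr => t _.
rewrite -!sum_nat_const.
transitivity (\sum_j \sum_(x in A) \sum_(y in B) (a j t x && b j t y))%N.
  apply: eq_bigr => j _; rewrite -!sum1_card.
  rewrite (eq_bigl (fun x => (x \in A) && a j t x)); last by move=> x; rewrite inE.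
  rewrite [X in (_ * X)%N](eq_bigl (fun y => (y \in B) && b j t y)); last by move=> y;
    rewrite inE.
  rewrite !big_mkcondr big_distrl /=; apply: eq_bigr => x _.
  rewrite big_distrr /=; apply: eq_bigr => y _.
  by case: (a j t x); case: (b j t y).
rewrite exchange_big /=; apply: eq_bigr => x xA.
by rewrite exchange_big /=; apply: eq_bigr => y yB; exact: sumc.
Qed.

Section Covering.
Variables (K : realFieldType) (m h l : nat) (theta : K) (J : finType).
Local Notation V := (vertex m h l).
Local Notation Q := (block_matching h).
Local Notation q := #|{: Q}|.
Local Notation k := (3 + 2 * h)%N.
Variables (P : J -> pred {set V}) (R : J -> pred {perm V}).
Hypothesis fewQ : forall A : {set {ffun option 'I_m -> Q}},
  (\sum_o biased A o)%:R * #|A|%:R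
    <= m.+1%:R / 20%:R * #|A|%:R + m.+1%:R * (3 * theta ^+ m.+1 * q%:R ^+ m.+1).
Hypothesis few2 : forall A : {set {ffun option 'I_m -> bool}},
  (\sum_o biased A o)%:R * #|A|%:R
    <= m.+1%:R / 20%:R * #|A|%:R + m.+1%:R * (3 * theta ^+ m.+1 * #|{: bool}|%:R ^+ m.+1).
Hypothesis theta0 : 0 <= theta.
Hypothesis slack : forall (U : {set V}) (M : {perm V}), odd #|U| -> is_matching M ->
  (crossing U M = 1 + \sum_j (P j U && R j M))%N.
Hypothesis large_h : (64 * (k * (2 + 2 * h)) <= 'C(k, 3))%N.

Implicit Types (x : {ffun option 'I_m -> bool}) (y : {ffun option 'I_m -> Q}).

Let slackE c p x y : crossing (gadget_cut h l x) (gadget_mat l y) = (1 + c)%N ->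
  (\sum_j (P j (relabel p (gadget_cut h l x)) && R j (gadget_mat l y ^ p)%g) = c)%N.
Proof.
move=> cr; apply: (@addnI 1%N); rewrite -slack ?card_relabel ?odd_cut //.
  by rewrite crossing_relabel.
by rewrite conj_matching ?mat_matching.
Qed.

Let fiberE j p b : fiber (cuts (P j) p) None b
  = [set x in [set x : {ffun option 'I_m -> bool} | x None == b] | P j (relabel p
    (gadget_cut h l x))].
Proof. by apply/setP => x; rewrite !inE andbC. Qed.

Let fiberE' j p f : fiber (mats (R j) p) None f
  = [set y in [set y : {ffun option 'I_m -> Q} | y None == f] | R j (gadget_mat l y ^
    p)%g].
Proof. by apply/setP => y; rewrite !inE andbC. Qed.

Lemma sum_weight3 : \sum_j weight3 K (P j) (R j)
  = #|{perm V}|%:R * (2 ^+ m * (q%:R ^+ m.+1 * 2)) :> K.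
Proof.
transitivity ((\sum_j \sum_(p : {perm V})
   #|[set x in [set x : {ffun option 'I_m -> bool} | x None == false] | P j (relabel p
     (gadget_cut h l x))]|
   * #|[set y in setT | R j (gadget_mat l y ^ p)%g]|)%N%:R : K).
  rewrite natr_sum; apply: eq_bigr => j _; rewrite natr_sum; apply: eq_bigr => p _.
  rewrite natrM /cuts_at fiberE; congr (_ * _%:R).
  by apply: eq_card => y; rewrite !inE.
rewrite (@sum_rectangles _ _ _ _ _ _ _ _ 2) => [|p x y].
  by rewrite !natrM card_ffun_at cardsT card_ffun_option card_bool !natrX.
by rewrite inE => /eqP xN _; apply: slackE; rewrite crossing3_notin // xN.
Qed.

Lemma sum_weight3' : \sum_j weight3' K (P j) (R j)
  = #|{perm V}|%:R * (2 ^+ m.+1 * (q%:R ^+ m * 2)) :> K.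
Proof.
transitivity ((\sum_j \sum_(p : {perm V})
   #|[set x in setT | P j (relabel p (gadget_cut h l x))]|
   * #|[set y in [set y : {ffun option 'I_m -> Q} | y None == block_within h] | R j
     (gadget_mat l y ^ p)%g]|)%N%:R : K).
  rewrite natr_sum; apply: eq_bigr => j _; rewrite natr_sum; apply: eq_bigr => p _.
  rewrite natrM /mats_at fiberE'; congr (_%:R * _).
  by apply: eq_card => y; rewrite !inE.
rewrite (@sum_rectangles _ _ _ _ _ _ _ _ 2) => [|p x y].
  by rewrite !natrM card_ffun_at cardsT card_ffun_option card_bool !natrX.
by rewrite [y \in _]inE => _ /eqP yN; apply: slackE; rewrite crossing3_within.
Qed.

Lemma sum_weightk : \sum_j weightk K (P j) (R j)
  = #|{perm V}|%:R * (2 ^+ m * (q%:R ^+ m * (2 + 2 * h)%:R)) :> K.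
Proof.
transitivity ((\sum_j \sum_(p : {perm V})
   #|[set x in [set x : {ffun option 'I_m -> bool} | x None == true] | P j (relabel p
     (gadget_cut h l x))]|
   * #|[set y in [set y : {ffun option 'I_m -> Q} | y None == block_across h] | R j
     (gadget_mat l y ^ p)%g]|)%N%:R : K).
  rewrite natr_sum; apply: eq_bigr => j _; rewrite natr_sum; apply: eq_bigr => p _.
  by rewrite natrM /cuts_at /mats_at fiberE fiberE'.
rewrite (@sum_rectangles _ _ _ _ _ _ _ _ (2 + 2 * h)) => [|p x y].
  by rewrite !natrM !card_ffun_at card_bool !natrX.
rewrite !inE => /eqP xN /eqP yN; apply: slackE.
by rewrite crossing_across // xN.
Qed.

(** Sum [rectangle_bound] over [J] and divide by ['C(k, 3) * Z], where [Z] counts the triples of a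
    relabelling, a cut and a matching behind [weight3]. The left side becomes the slack 2; the right
    side is at most [2/20 + 8/20 + 1/2] plus the error, where [large_h] gives the 1/2. The error
    constant is 15 = 3 + 12. *)
Lemma covering_bound : 1 <= 15 * #|J|%:R * theta ^+ m.+1.
Proof.
have not1 j (U : {set V}) (M : {perm V}) : odd #|U| -> is_matching M -> P j U -> R j M ->
    crossing U M != 1%N.
  by move=> oU mM PU RM; rewrite slack // (bigD1 j) //= PU RM.
have q_gt0 : (0 < q)%N by apply/card_gt0P; exists (block_across h).
have G_gt0 : (0 < #|{perm V}|)%N by apply/card_gt0P; exists 1%g.
set t := theta ^+ m.+1.
pose Z : K := #|{perm V}|%:R * 2 ^+ m * q%:R ^+ m.+1.
have Z0 : 0 < Z by rewrite !mulr_gt0 ?exprn_gt0 ?ltr0n.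
have C0 : 0 < 'C(k, 3)%:R :> K by rewrite ltr0n bin_gt0 leq_addr.
have bound j : 'C(k, 3)%:R * weight3 K (P j) (R j) <=
    'C(k, 3)%:R * (20^-1 * weight3 K (P j) (R j) + 15 * t * Z)
    + 'C(k, 3)%:R * (2 * q%:R * 20^-1) * weight3' K (P j) (R j)
    + 8 * q%:R * (4 * k)%:R * weightk K (P j) (R j).
  apply: le_trans (rectangle_bound fewQ few2 (@not1 j) theta0) _.
  by rewrite le_eqVlt; apply/orP; left; apply/eqP; rewrite /Z /t !exprS; ring.
have [c cE] : {c | c = 15 * t * Z} by exists (15 * t * Z).
have sumc : \sum_(j : J) c = #|J|%:R * c by rewrite sumr_const mulr_natl.
have := ler_sum (index_enum J) (fun j (_ : true) => bound j); rewrite -cE.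
rewrite !big_split /= -!mulr_sumr big_split /= -mulr_sumr sumc {c sumc}cE.
rewrite sum_weight3 sum_weight3' sum_weightk.
have -> : #|{perm V}|%:R * (2 ^+ m * (q%:R ^+ m.+1 * 2)) = 2 * Z by rewrite /Z; ring.
have -> : 8 * q%:R * (4 * k)%:R * (#|{perm V}|%:R * (2 ^+ m * (q%:R ^+ m * (2 + 2 *
  h)%:R)))
   = 32 * (k * (2 + 2 * h))%:R * Z by rewrite /Z !natrM exprS; ring.
have -> : 'C(k, 3)%:R * (2 * q%:R * 20^-1) * (#|{perm V}|%:R * (2 ^+ m.+1 *
  (q%:R ^+ m * 2)))
   = 'C(k, 3)%:R * (8 / 20 * Z) by rewrite /Z !exprS; ring.
move: large_h; rewrite -(ler_nat K) natrM => /(ler_wpM2r (ltW Z0)).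
set C : K := 'C(k, 3)%:R in C0 *; set D : K := (k * _)%:R => leD le.
have CZ0 : 0 < C * Z by exact: mulr_gt0.
rewrite -(ler_pM2r CZ0) mul1r; lra.
Qed.

End Covering.

Definition slack_cover (V J : finType) (P : J -> pred {set V}) (R : J -> pred {perm V}) :=
  forall (U : {set V}) (M : {perm V}), odd #|U| -> is_matching M ->
    (crossing U M = 1 + \sum_j (P j U && R j M))%N.

Lemma slack_cover_transfer (V V' J : finType)
    (P : J -> pred {set V'}) (R : J -> pred {perm V'}) :
  #|V| = #|V'| -> slack_cover P R ->
  exists (P' : J -> pred {set V}) (R' : J -> pred {perm V}), slack_cover P' R'.
Proof.
move=> cardV cov.
pose f (v : V) : V' := enum_val (cast_ord cardV (enum_rank v)).
pose g (v : V') : V := enum_val (cast_ord (esym cardV) (enum_rank v)).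
have fK : cancel f g by move=> v; rewrite /g /f enum_valK cast_ordK enum_rankK.
have gK : cancel g f by move=> v; rewrite /g /f enum_valK cast_ordKV enum_rankK.
have cM_inj (M : {perm V}) : injective (fun v => f (M (g v))).
  exact: inj_comp (can_inj fK) (inj_comp perm_inj (can_inj gK)).
pose cM M : {perm V'} := perm (cM_inj M).
have f_mem (U : {set V}) v : (f v \in f @: U) = (v \in U) by rewrite mem_imset //;
  exact: can_inj fK.
exists (fun j (U : {set V}) => P j (f @: U)), (fun j M => R j (cM M)) => U M oddU mM.
rewrite -(cov (f @: U) (cM M)).
- rewrite /crossing -(card_imset _ (can_inj fK)); apply: eq_card => v.
  by rewrite -[v]gK f_mem !inE f_mem permE fK f_mem.
- by rewrite card_imset //; exact: can_inj fK.
- have [MK M_neq] := matchingP _ mM; apply/matchingP; split=> v; rewrite !permE.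
    by rewrite fK MK gK.
  by apply: contra (M_neq (g v)) => /eqP {2}<-; rewrite fK.
Qed.

Lemma pow_small (theta : rat) : 0 < theta < 1 ->
  exists2 e, (0 < e)%N & theta ^+ e <= 2^-1.
Proof.
move=> /andP[t0 t1]; pose u := 1 - theta.
have u0 : 0 < u by rewrite subr_gt0.
have [e eu] : exists e, 1 < e%:R * u.
  exists (Num.bound u^-1).
  by rewrite -ltr_pdivrMr // mul1r; apply: archi_boundP; rewrite invr_ge0 ltW.
have e0 : (0 < e)%N by case: e eu => //; rewrite mul0r ltr10.
exists e => //.
have bern n : theta ^+ n * (1 + n%:R * u) <= 1.
  elim: n => [|n IH]; first by rewrite mul0r addr0 mulr1 expr0.
  apply: le_trans IH; rewrite exprS mulrAC mulrC ler_wpM2l ?exprn_ge0 ?ltW //.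
  rewrite -natr1; have -> : theta = 1 - u by rewrite /u; ring.
  by have := ler0n rat n; nra.
have {bern} := bern e; have := exprn_gt0 e t0; move: (theta ^+ e) (e%:R * u) eu => x y.
nra.
Qed.

Lemma few_biased_mono (I Q : finType) (q E : nat) (t t' : rat) (S : {set {ffun I -> Q}}) :
  0 <= t -> t <= t' ->
  (\sum_(i : I) biased S i)%:R * #|S|%:R
      <= #|I|%:R / E%:R * #|S|%:R + #|I|%:R * (3 * t ^+ #|I| * q%:R ^+ #|I|) ->
  (\sum_(i : I) biased S i)%:R * #|S|%:R
      <= #|I|%:R / E%:R * #|S|%:R + #|I|%:R * (3 * t' ^+ #|I| * q%:R ^+ #|I|).
Proof.
move=> t0 tt' /le_trans; apply.
rewrite lerD2l ler_wpM2l ?ler0n // ler_wpM2r ?exprn_ge0 ?ler0n // ler_wpM2l //.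
by rewrite lerXn2r // nnegrE // (le_trans t0).
Qed.

(** The larger of the two rates, for cuts and for matchings, serves both; it depends on [h] alone
    and is uniform in the number of blocks. *)
Lemma vertex_cover_bound (h : nat) :
  (64 * ((3 + 2 * h) * (2 + 2 * h)) <= 'C(3 + 2 * h, 3))%N ->
  exists2 theta : rat, 0 < theta < 1 & forall m l (J : finType)
    (P : J -> pred {set vertex m h l}) (R : J -> pred {perm vertex m h l}),
    slack_cover P R -> 1 <= 15 * #|J|%:R * theta ^+ m.+1.
Proof.
move=> large_h.
have q_gt0 : (0 < #|{: block_matching h}|)%N by apply/card_gt0P; exists (block_across h).
have [t1 /andP[t10 t11] few1] := few_biased rat q_gt0 (isT : (0 < 20)%N).
have [t2 /andP[t20 t21] few2] := few_biased rat (isT : (0 < 2)%N) (isT : (0 < 20)%N).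
exists (Num.max t1 t2); first by rewrite lt_max t10 gt_max t11.
move=> m l J P R cov.
have cardI : #|{: option 'I_m}| = m.+1 by rewrite card_option card_ord.
apply: (covering_bound _ _ _ cov large_h) => [A|A|]; last by rewrite le_max ltW.
  have le1 : t1 <= Num.max t1 t2 by rewrite le_max lexx.
  have := few_biased_mono (ltW t10) le1 (few1 _ (block_matching h) erefl A).
  by rewrite cardI.
have le2 : t2 <= Num.max t1 t2 by rewrite le_max lexx orbT.
have := few_biased_mono (ltW t20) le2 (few2 _ bool card_bool A).
by rewrite cardI card_bool.
Qed.

Lemma slack_cover_exponential : exists e n0 : nat, (0 < e)%N /\
  forall n (J : finType) (P : J -> pred {set 'I_n.*2}) (R : J -> pred {perm 'I_n.*2}),
  (n0 <= n)%N -> slack_cover P R -> (2 ^ (n %/ e) <= #|J|)%N.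
Proof.
have [h h_gt0 large_h] : exists2 h, (0 < h)%N & (64 * ((3 + 2 * h) * (2 + 2 * h)) <=
  'C(3 + 2 * h, 3))%N.
  (* As ['C(k, 3) = k (k - 1) (k - 2) / 6], it is enough that [k - 2 = 1 + 2 h] is at least
     [64 * 6 = 384]. *)
  suff large h : (192 <= h)%N -> (64 * ((3 + 2 * h) * (2 + 2 * h)) <= 'C(3 + 2 * h, 3))%N.
    by exists 192%N; last exact: large.
  move=> le_h; rewrite -(@leq_pmul2r (3`!)) // bin_ffact !ffactnS ffactn0 muln1.
  have -> : ((3 + 2 * h).-1 = 2 + 2 * h)%N by lia.
  have -> : ((2 + 2 * h).-1 = 1 + 2 * h)%N by lia.
  rewrite [leqRHS]mulnA -mulnA mulnCA leq_mul2l; apply/orP; right.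
  by rewrite (_ : 3`! = 6)%N //; lia.
have [theta theta01 bound] := vertex_cover_bound large_h.
have [theta0 theta1] := andP theta01.
have [e0 e0_gt0 small] := pow_small theta01.
(* An A-block and a B-block use [6 h] vertices, so [m] is about [n / (3 h)]. Half of it provides the
   exponent [t]; the other half absorbs the core, the leftover and 4 further halvings, since 1/16
   beats the constant 15. *)
exists (6 * h * e0)%N, (24 * h * e0 + 6 + 4 * h)%N; split; first by nia.
move=> n J P R le_n cov.
pose d := (n - (3 + 2 * h))%N; pose m := (d %/ (3 * h))%N; pose l := (d %% (3 * h))%N.
have dE : (d = m * (3 * h) + l)%N by rewrite /m /l -divn_eq.
have l_lt : (l < 3 * h)%N by rewrite ltn_mod; lia.
have cardV : #|{: vertex m h l}| = #|'I_n.*2|.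
  by rewrite card_vertex card_ord -mul2n; congr (2 * _)%N; rewrite /d in dE; nia.
have [P' [R' cov']] := slack_cover_transfer cardV cov.
have {cov' bound} := bound _ _ _ _ _ cov'.
set t := (n %/ (6 * h * e0))%N.
have t_le : (t * (6 * h * e0) <= n)%N by exact: leq_divM.
have le_m : (e0 * (t + 4) <= m.+1)%N.
  rewrite -(@leq_pmul2r (3 * h)) ?muln_gt0 //.
  rewrite /d in dE; nia.
have le_pow : theta ^+ m.+1 <= 2^-1 ^+ (t + 4).
  apply: le_trans (_ : theta ^+ (e0 * (t + 4)) <= _).
    by apply: ler_wiXn2l => //; exact: ltW.
  by rewrite exprM lerXn2r // nnegrE ?exprn_ge0 ?invr_ge0 ?ltW.
move=> le1.
have : 1 <= 15 * #|J|%:R * (2^-1 ^+ (t + 4)) :> rat.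
  by apply: le_trans le1 _; rewrite ler_wpM2l // mulr_ge0.
have p0 : 0 < 2 ^+ t :> rat by exact: exprn_gt0.
rewrite -(ler_nat rat) natrX exprD exprVn => le2.
rewrite -(@ler_pM2r _ (2 ^+ t)^-1) ?invr_gt0 // mulfV ?lt0r_neq0 //.
apply: le_trans le2 _.
have J0 : 0 <= #|J|%:R / 2 ^+ t :> rat by rewrite mulr_ge0 ?ler0n ?invr_ge0 ?ltW.
have -> : 15 * #|J|%:R * ((2 ^+ t)^-1 * 2^-1 ^+ 4) = (#|J|%:R / 2 ^+ t) *
  (15 / 16) :> rat.
  have -> : 2^-1 ^+ 4 = 16^-1 :> rat by [].
  ring.
lra.
Qed.

(** * From projections to labelled permutations *)

Section OrderedSemiring.
Variable R : totalOrderSemiRingType.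
Implicit Types (a b c d : R).
Local Notation le := (@tosr_le R).

Lemma tosr_leD a b c d : le a b -> le c d -> le (a + c) (b + d).
Proof.
move=> ab cd; apply: tosr_le_trans _ _ _ (tosr_leD2r _ _ _ ab) _.
by rewrite ![b + _]addrC; exact: tosr_leD2r.
Qed.

Lemma tosr_leM a b c d : nonneg a -> nonneg d -> le a b -> le c d -> le (a * c) (b * d).
Proof.
move=> a0 d0 ab cd; apply: (@tosr_le_trans R (a * d)); last exact: tosr_leM2r.
by rewrite ![a * _]mulrC; exact: tosr_leM2r.
Qed.

Lemma nonnegD a b : nonneg a -> nonneg b -> nonneg (a + b).
Proof. by move=> a0 b0; rewrite /nonneg -[0]addr0; exact: tosr_leD. Qed.

Lemma nonnegM a b : nonneg a -> nonneg b -> nonneg (a * b).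
Proof. by move=> a0 b0; rewrite /nonneg -[0](mul0r b); exact: tosr_leM2r. Qed.

(** The index [i] excludes the empty product, which would require 0 <= 1; the induction starts from
    the factor [F i]. *)
Lemma nonneg_prod (I : finType) (F : I -> R) (i : I) :
  (forall j, nonneg (F j)) -> nonneg (\prod_j F j).
Proof.
move=> F0; rewrite (bigD1 i) //=; move: (F i) (F0 i).
elim/big_rec: _ => [|j x _ IH] c c0; first by rewrite mulr1.
by rewrite mulrA; apply: IH; exact: nonnegM.
Qed.

(** Whichever way 0 and 1 compare, [N] lies on the same side of 0 as 1. If [N.+1] were 0, adding 1
    to that comparison would give the reverse comparison of 0 and 1. *)
Lemma natrS_neq0 N : N.+1%:R != 0 :> R.
Proof.
apply/eqP => N0; have := oner_neq0 R; rewrite (_ : 1 = 0 :> R) ?eqxx //.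
apply: tosr_le_anti; case/orP: (tosr_le_total (1 : R) 0) => le1; rewrite le1 ?andbT /=.
  have le_nat n : le n%:R 0.
    elim: n => [|n IH]; first exact: tosr_le_refl.
    by rewrite -natr1 -[0]addr0; exact: tosr_leD.
  have := tosr_leD2r _ _ 1 (le_nat N).
  by rewrite natr1 N0 add0r.
have le_nat n : le 0 n%:R.
  elim: n => [|n IH]; first exact: tosr_le_refl.
  by rewrite -natr1 -[0]addr0; exact: tosr_leD.
have := tosr_leD2r _ _ 1 (le_nat N).
by rewrite natr1 N0 add0r.
Qed.

Lemma nonneg1_of_nat N : nonneg (N.+1%:R : R) -> nonneg (1 : R).
Proof.
move=> N0; case/orP: (tosr_le_total (1 : R) 0) => // le10.
have le_nat n : le n%:R 0.
  elim: n => [|n IH]; first exact: tosr_le_refl.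
  by rewrite -natr1 -[0]addr0; exact: tosr_leD.
case/eqP: (natrS_neq0 N); apply: tosr_le_anti.
by rewrite le_nat.
Qed.

Lemma nonneg0 : nonneg (0 : R).
Proof. exact: tosr_le_refl. Qed.

Lemma nonneg_sum (I : Type) (r : seq I) (P : pred I) (F : I -> R) :
  (forall i, P i -> nonneg (F i)) -> nonneg (\sum_(i <- r | P i) F i).
Proof. by move=> F0; elim/big_rec: _ => [|i x Pi x0];
  [exact: nonneg0|exact: nonnegD (F0 _ Pi) x0]. Qed.

Lemma tosr_le_sum (I : finType) (P : pred I) (F : I -> R) i :
  (forall j, P j -> nonneg (F j)) -> P i -> le (F i) (\sum_(j | P j) F j).
Proof.
move=> F0 Pi; rewrite (bigD1 i) //= -{1}[F i]addr0.
apply: tosr_leD; first exact: tosr_le_refl.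
by apply: nonneg_sum => j /andP[/F0].
Qed.

(* Zero divisors may make a product of non-zero coefficients vanish, so being
   non-zero is replaced by dividing an element above 1, which is stable under
   products and factors. *)
Definition ample c : Prop := exists2 d, nonneg d & le 1 (c * d).

(** The largest term multiplied by the number of terms dominates the sum, and this number is the
    required multiplier. *)
Lemma ample_sum (I : finType) (P : pred I) (F : I -> R) : ~~ le 1 0 -> nonneg (1 : R) ->
  (forall i, P i -> nonneg (F i)) -> le 1 (\sum_(i | P i) F i) ->
  exists2 i, P i & ample (F i).
Proof.
move=> n10 n1 F0 le1.
have nat0 N : nonneg (N%:R : R).
  by elim: N => [|N IH]; [exact: nonneg0|rewrite -natr1; exact: nonnegD].
have max (r : seq I) : \sum_(i <- r | P i) F i = 0 \/
    exists i N, P i /\ le (\sum_(i <- r | P i) F i) (F i * N%:R).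
  elim: r => [|i r IH]; first by left; rewrite big_nil.
  rewrite big_cons; case: ifP => // Pi; right.
  case: IH => [->|[j [N [Pj le_j]]]].
    by exists i, 1%N; rewrite mulr1 addr0; split=> //; exact: tosr_le_refl.
  have [le_ij|le_ji] := orP (tosr_le_total (F i) (F j)).
    exists j, N.+1; split=> //; rewrite -natr1 mulrDr mulr1 addrC.
    exact: tosr_leD.
  exists i, N.+1; split=> //; rewrite -natr1 mulrDr mulr1 addrC.
  apply: tosr_leD; last exact: tosr_le_refl.
  by apply: tosr_le_trans _ _ _ le_j _; apply: tosr_leM2r => //; exact: nat0.
case: (max (index_enum I)) => [sum0|[i [N [Pi le_i]]]].
  by move: le1; rewrite sum0 (negPf n10).
by exists i => //; exists N%:R; [exact: nat0|exact: tosr_le_trans _ _ _ le1 le_i].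
Qed.

Lemma ample_prod (I : finType) (F : I -> R) : nonneg (1 : R) ->
  (forall i, ample (F i)) -> ample (\prod_i F i).
Proof.
move=> n1 aF; elim/big_rec: _ => [|i x _ [d d0 le1]].
  by exists 1 => //; rewrite mulr1; exact: tosr_le_refl.
have [e e0 le1'] := aF i; exists (e * d); first exact: nonnegM.
rewrite mulrACA -[1]mulr1; apply: tosr_leM => //.
exact: tosr_le_trans _ _ _ n1 le1.
Qed.

Lemma prod_ample (I : finType) (F : I -> R) i : nonneg (1 : R) ->
  (forall j, nonneg (F j)) -> ample (\prod_j F j) -> ample (F i).
Proof.
move=> n1 F0 [d d0]; rewrite (bigD1 i) //= -mulrA => le1.
exists (\prod_(j | j != i) F j * d) => //; apply: nonnegM => //.
by elim/big_rec: _ => // j x _ x0; exact: nonnegM.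
Qed.

End OrderedSemiring.

(** * Substitution into the permanent *)

Section Substitution.
Variables (V : finType) (R : comNzSemiRingType).

Lemma spmono_mul (k k' : monom V) (c c' : R) :
  spmono k c * spmono k' c' = spmono (k + k') (c * c').
Proof. exact: spmul_mono. Qed.

Lemma spmono_prod (I : finType) (k : I -> monom V) (c : I -> R) :
  \prod_i spmono (k i) (c i) = spmono (\sum_i k i) (\prod_i c i).
Proof. by elim/big_rec3: _ => // i x y z _ ->; exact: spmono_mul. Qed.

Variables (W : finType) (f : W -> {spoly R[V]}).

Lemma spsubst_wide (D : {fset monom W}) (g : {spoly R[W]}) : (spsupp g `<=` D)%fset ->
  spsubst f g = \sum_(k <- D) spconst V (spcoef k g) * \prod_w f w ^+ k w.
Proof.
move=> le; rewrite /spsubst (big_fset_incl _ le) //= => k _ /spcoef_out ->.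
by rewrite /spconst raddf0 mul0r.
Qed.

Lemma spsubst0 : spsubst f 0 = 0.
Proof. by rewrite /spsubst spsupp0 big_seq_fset0. Qed.

Lemma spsubstD (g g' : {spoly R[W]}) : spsubst f (g + g') = spsubst f g + spsubst f g'.
Proof.
rewrite (spsubst_wide (spsuppD_le g g')).
rewrite (spsubst_wide (fsubsetUl (spsupp g) (spsupp g'))).
rewrite (spsubst_wide (fsubsetUr (spsupp g) (spsupp g'))) -big_split /=.
by apply: eq_bigr => k _; rewrite !raddfD /= /spconst raddfD mulrDl.
Qed.

Lemma spsubst_mono k c : spsubst f (spmono k c) = spconst V c * \prod_w f w ^+ k w.
Proof. by rewrite (spsubst_wide (spsupp_mono_le k c)) big_seq_fset1 spcoef_monoE. Qed.

End Substitution.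

Lemma spsubst_permanent (V : finType) (R : comNzSemiRingType) m
    (f : 'I_m * 'I_m -> {spoly R[V]}) :
  spsubst f (permanent R m) = \sum_(s : 'S_m) \prod_i f (i, s i).
Proof.
rewrite /permanent (big_morph _ (spsubstD f) (spsubst0 f)).
apply: eq_bigr => s _; rewrite spmono_prod spsubst_mono big1 // mul1r.
transitivity (\prod_w \prod_(i < m) f w ^+ (w == (i, s i))).
  apply: eq_bigr => w _; rewrite prodrXr; congr (_ ^+ _).
  by rewrite sum_ffunE; apply: eq_bigr => i _; rewrite ffunE.
rewrite exchange_big /=; apply: eq_bigr => i _.
by rewrite (bigD1 (i, s i)) //= eqxx big1 ?mulr1 // => w /negPf ->.
Qed.

(** A label picks a term of an affine form; [None] stands for the constant term. *)
Definition label_monom (V : finType) (t : option V) : monom V :=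
  if t is Some v then [ffun w => nat_of_bool (w == v)] else 0.

Lemma nonneg_affineE (V : finType) (R : totalOrderSemiRingType) (f : {spoly R[V]}) :
  nonneg_affine f -> exists2 a : option V -> R, forall t, nonneg (a t) &
    f = \sum_t spmono (label_monom t) (a t).
Proof.
move=> [a0 [a [a0_ge0 a_ge0 ->]]].
exists (fun t => if t is Some v then a v else a0); first by case.
rewrite (bigD1 None) //=; congr (_ + _).
rewrite (reindex_omap Some id) /=; last by case.
apply: eq_big => [v|v _]; first by rewrite eqxx.
by rewrite /spconst /spvar spmono_mul add0r mulr1.
Qed.

Section Projection.
Variables (V : finType) (R : totalOrderSemiRingType) (m : nat).

(** Expanding the products of affine entries gives one term for each permutation together with a
    label in every row. *)
Lemma projection_coefs (f : {spoly R[V]}) :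
  monotone_affine_projection f (permanent R m) ->
  exists2 a : 'I_m -> 'I_m -> option V -> R, forall i j t, nonneg (a i j t) &
  forall k, spcoef k f = \sum_(st : 'S_m * {ffun 'I_m -> option V}
      | \sum_i label_monom (st.2 i) == k) \prod_i a i (st.1 i) (st.2 i).
Proof.
move=> [l [l_aff ->]].
have [a aP] : exists a, forall w, (forall t, nonneg (a w t)) /\
    l w = \sum_t spmono (label_monom t) (a w t).
  have exa w : exists b : option V -> R, (forall t, nonneg (b t)) /\
      l w = \sum_t spmono (label_monom t) (b t).
    by have [b b0 lb] := nonneg_affineE (l_aff w); exists b.
  by exists (fun w => sval (cid (exa w))) => w; exact: (svalP (cid (exa w))).
exists (fun i j => a (i, j)) => [i j t|k]; first exact: (aP _).1.
rewrite spsubst_permanent raddf_sum /= [RHS]big_mkcond /=.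
rewrite -(pair_bigA _ (fun (s : 'S_m) (t : {ffun 'I_m -> option V}) =>
  if \sum_i label_monom (t i) == k then \prod_i a (i, s i) (t i) else 0)) /=.
apply: eq_bigr => s _.
under eq_bigr do rewrite (aP _).2.
rewrite bigA_distr_bigA raddf_sum /=; apply: eq_bigr => t _.
by rewrite spmono_prod spcoef_mono; case: eqP.
Qed.

End Projection.

Local Close Scope ring_scope.

(** * Perfect matchings as permutations and as monomials *)

Section MatchingPerm.
Variable n : nat.
Local Notation V := 'I_n.*2.

Lemma half_ltn (p : V) : p./2 < n.
Proof. by have := ltn_ord p; lia. Qed.

Definition position_half (p : V) : 'I_n := Ordinal (half_ltn p).

Lemma even_odd_pos (p : V) :
  p = if odd p then odd_pos (position_half p) else even_pos (position_half p).
Proof.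
by apply: val_inj; case: ifP => odd_p /=; rewrite -[LHS]odd_double_half odd_p.
Qed.

Lemma sum_even_odd (F : V -> nat) :
  \sum_p F p = \sum_(i < n) (F (even_pos i) + F (odd_pos i)).
Proof.
pose J (ib : 'I_n * bool) : V := if ib.2 then odd_pos ib.1 else even_pos ib.1.
pose J' (p : V) := (position_half p, odd p).
have JK : cancel J J'.
  case=> i b; rewrite /J /J' /=; congr (_, _).
    by apply: val_inj; case: b => /=; lia.
  by case: b => /=; lia.
have J'K : cancel J' J by move=> p; rewrite {2}(even_odd_pos p).
rewrite (reindex J) /=; last by exists J' => x _.
rewrite -(pair_bigA _ (fun i b => F (J (i, b)))) /=; apply: eq_bigr => i _.
by rewrite big_bool /= addnC.
Qed.

Lemma matching_perm1 : matching_perm (1%g : 'S_n.*2).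
Proof.
apply/andP; split; apply/forallP => i; last by rewrite !perm1 /=.
by apply/forallP => j; apply/implyP => lt_ij; rewrite !perm1 /= ltn_double.
Qed.

(** List the smaller endpoints of the edges in increasing order at the even positions, and their
    partners at the odd ones. *)
Lemma matching_perm_exists (M : {perm V}) : is_matching M ->
  exists2 s : 'S_n.*2, matching_perm s & forall i, M (s (even_pos i)) = s (odd_pos i).
Proof.
move=> /matchingP[MK M_neq]; pose S := [set v : V | v < M v].
have cardS : #|S| = n.
  have MS : ~: S = [set M v | v in S].
    apply/setP => v; rewrite !inE -leqNgt; apply/idP/imsetP => [le_v|[w wS ->]].
      exists (M v); rewrite ?inE MK // ltn_neqAle le_v andbT.
      by rewrite (inj_eq val_inj) M_neq.
    by rewrite inE in wS; rewrite MK ltnW.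
  have := cardsC S; rewrite MS card_imset ?card_ord; last exact: perm_inj.
  by rewrite addnn => /double_inj.
have lt_size (i : 'I_n) : i < size (enum S) by rewrite -cardE cardS.
pose e (i : 'I_n) : V := nth (even_pos i) (enum S) i.
have e_nth v0 i : e i = nth v0 (enum S) i by exact: set_nth_default.
have eS i : e i < M (e i).
  have : e i \in S by rewrite -mem_enum mem_nth.
  by rewrite inE.
have sortedS : sorted ltn (map val (enum S)).
  have sub : subseq (map val (enum S)) (map val (enum V)).
    by apply: map_subseq; rewrite [enum S]/enum_mem -enumT; exact: filter_subseq.
  by apply: (subseq_sorted ltn_trans sub); rewrite val_enum_ord; exact: iota_ltn_sorted.
have e_lt (i j : 'I_n) : i < j -> e i < e j.
  move=> lt_ij; rewrite !(e_nth (even_pos i)).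
  have := sorted_ltn_nth ltn_trans 0 sortedS.
  move=> /(_ i j); rewrite !inE !size_map !lt_size => /(_ isT isT lt_ij).
  by rewrite !(nth_map (even_pos i)).
have e_inj (i j : 'I_n) : e i = e j -> i = j.
  move=> eq_e; apply: val_inj; case: (ltngtP i j) => // /e_lt; rewrite eq_e ltnn //.
pose f (p : V) : V := if odd p then M (e (position_half p)) else e (position_half p).
have f_even i : f (even_pos i) = e i.
  rewrite /f /= odd_double; congr (e _); apply: val_inj => /=; lia.
have f_odd i : f (odd_pos i) = M (e i).
  rewrite /f /= odd_double; congr (M (e _)); apply: val_inj => /=; lia.
have M_inj := can_inj MK.
have eM i j : e i <> M (e j).
  by move=> eq_e; have := eS i; rewrite eq_e MK => /ltn_trans/(_ (eS j)); rewrite ltnn.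
have f_inj : injective f.
  move=> p p'; rewrite (even_odd_pos p) (even_odd_pos p').
  case: (odd p); case: (odd p'); rewrite ?f_even ?f_odd.
  - by move=> /M_inj/e_inj ->.
  - by move=> /esym/eM.
  - by move=> /eM.
  - by move=> /e_inj ->.
exists (perm f_inj) => [|i]; last by rewrite !permE f_even f_odd.
apply/andP; split; apply/forallP => i; last by rewrite !permE f_even f_odd.
apply/forallP => j; apply/implyP => lt_ij; rewrite !permE !f_even; exact: e_lt.
Qed.

Definition crosses (U : {set V}) (t : option (edge n)) : bool :=
  if t is Some e then ((val e).1 \in U) (+) ((val e).2 \in U) else false.

(** The degree of a monomial in the edges crossing [U]. Since it depends on the monomial alone, it
    transfers crossing numbers between matchings and labellings with the same monomial. *)
Definition monom_crossing (U : {set V}) (k : monom (edge n)) : nat :=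
  \sum_e k e * crosses U (Some e).

Lemma monom_crossing_sum U (I : finType) (t : I -> option (edge n)) :
  monom_crossing U (\sum_i label_monom (t i))%R = \sum_i crosses U (t i).
Proof.
rewrite /monom_crossing.
under eq_bigr do rewrite sum_ffunE big_distrl /=.
rewrite exchange_big /=; apply: eq_bigr => i _.
case: (t i) => [e|] /=; last by rewrite big1 // => e _; rewrite ffunE.
rewrite (bigD1 e) //= ffunE eqxx mul1n big1 ?addn0 // => e' /negPf ne.
by rewrite ffunE ne.
Qed.

Definition perm_label (s : 'S_n.*2) (i : 'I_n) : option (edge n) :=
  insub (s (even_pos i), s (odd_pos i)).

Definition perm_monom (s : 'S_n.*2) : monom (edge n) :=
  (\sum_i label_monom (perm_label s i))%R.

Lemma perm_monom_crossing (s : 'S_n.*2) U : matching_perm s ->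
  monom_crossing U (perm_monom s)
    = \sum_i ((s (even_pos i) \in U) (+) (s (odd_pos i) \in U)).
Proof.
move=> /andP[_ /forallP lt_s]; rewrite monom_crossing_sum; apply: eq_bigr => i _.
rewrite /perm_label; case: insubP => [e _ /= ->|] //=.
by rewrite (lt_s i).
Qed.

Lemma perm_monom_crossing_matching (M : {perm V}) (s : 'S_n.*2) U : is_matching M ->
  matching_perm s -> (forall i, M (s (even_pos i)) = s (odd_pos i)) ->
  monom_crossing U (perm_monom s) = crossing U M.
Proof.
move=> /matchingP[MK _] ms Ms;
  rewrite perm_monom_crossing // /crossing -sum1_card [RHS]big_mkcond /=.
rewrite [RHS](reindex_inj (@perm_inj _ s)) /=.
rewrite -[RHS]/(\sum_(p : V) (if s p \in [set v in U | M v \notin U] then 1 else 0)).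
rewrite sum_even_odd; apply: eq_bigr => i _.
have Ms' : M (s (odd_pos i)) = s (even_pos i) by rewrite -Ms MK.
rewrite !inE Ms Ms'; case: (s (even_pos i) \in U); by case: (s (odd_pos i) \in U).
Qed.

(** If no edge crosses, [U] is a union of matched pairs. *)
Lemma perm_monom_crossing_gt0 (s : 'S_n.*2) (U : {set V}) : matching_perm s -> odd #|U| ->
  0 < monom_crossing U (perm_monom s).
Proof.
move=> ms; apply: contraTT; rewrite -eqn0Ngt perm_monom_crossing // => /eqP/eqP.
rewrite sum_nat_eq0 => /forallP same.
rewrite -sum1_card big_mkcond (reindex_inj (@perm_inj _ s)) /=.
rewrite -[\sum_j _]/(\sum_(p : V) (if s p \in U then 1 else 0)) sum_even_odd.
rewrite (eq_bigr (fun i => 2 * (s (even_pos i) \in U))).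
  by rewrite -big_distrr oddM.
move=> i _; have := same i.
by case: (s (even_pos i) \in U); case: (s (odd_pos i) \in U).
Qed.

End MatchingPerm.

Local Open Scope ring_scope.

Lemma spcoef_PM (R : comNzSemiRingType) n k :
  spcoef k (PM R n) = #|[set s : 'S_n.*2 | matching_perm s && (perm_monom s == k)]|%:R.
Proof.
rewrite /PM raddf_sum /= -sum1_card natr_sum big_mkcond [RHS]big_mkcond /=.
apply: eq_bigr => s _; rewrite inE; case ms: (matching_perm s) => //=.
rewrite (eq_bigr (fun i => spmono (label_monom (perm_label s i)) 1)).
  by rewrite spmono_prod big1_eq spcoef_mono /perm_monom; case: eqP.
move=> i _; rewrite /edge_var /perm_label; case: insubP => //=.
by move: ms => /andP[_ /forallP/(_ i) lt_s]; rewrite /= lt_s.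
Qed.

(** [L] says that the coefficient of a label in an entry is ample. A matching has coefficient at
    least 1, so some term of its expansion is ample, hence so are all its factors. Conversely a
    product of ample coefficients is not 0 and cannot cancel among non-negative terms, so its
    monomial occurs in [PM]. *)
Lemma projection_labels (R : totalOrderSemiRingType) n m : (0 < n)%N ->
  monotone_affine_projection (PM R n) (permanent R m) ->
  exists L : 'I_m -> 'I_m -> option (edge n) -> bool,
    (forall M : {perm 'I_n.*2}, is_matching M ->
      exists (s : 'S_m) (t : 'I_m -> option (edge n)), (forall i, L i (s i) (t i)) /\
        forall U, crossing U M = (\sum_i crosses U (t i))%N)
    /\ forall (s : 'S_m) (t : 'I_m -> option (edge n)), (forall i, L i (s i) (t i)) ->
        forall U : {set 'I_n.*2}, odd #|U| -> (0 < \sum_i crosses U (t i))%N.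
Proof.
move=> n_gt0 /projection_coefs[a a0 coefs].
have coef1 : exists N, spcoef (perm_monom 1) (PM R n) = N.+1%:R.
  rewrite spcoef_PM; set A := [set s | _]; have : (0 < #|A|)%N.
    by apply/card_gt0P; exists 1%g; rewrite inE matching_perm1 eqxx.
  by case: #|A| => // N _; exists N.
(* For [m = 0] only the monomial 0 could occur, but a matching monomial crosses every singleton. A
   row is needed for [nonneg_prod]. *)
have m_gt0 : (0 < m)%N.
  case: m a a0 coefs => // a _ coefs.
  case: coef1 => N; rewrite coefs big1 => [/esym/eqP|st];
    first by rewrite (negPf (natrS_neq0 _ _)).
  rewrite big_ord0 => /eqP monom0.
  have n2_gt0 : (0 < n.*2)%N by rewrite double_gt0.
  have := @perm_monom_crossing_gt0 n 1 [set Ordinal n2_gt0] (matching_perm1 n).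
  rewrite cards1 -monom0 => /(_ isT).
  by rewrite /monom_crossing big1 // => e _; rewrite ffunE.
have prod0 (st : 'S_m * {ffun 'I_m -> option (edge n)}) :
    nonneg (\prod_i a i (st.1 i) (st.2 i)).
  exact: nonneg_prod (Ordinal m_gt0) _.
(* A positive natural number is a sum of non-negative products, which settles the sign of 1. *)
have n1 : nonneg (1 : R).
  case: coef1 => N eqN; apply: (@nonneg1_of_nat _ N); rewrite -eqN coefs.
  by apply: nonneg_sum => st _; exact: prod0.
have n10 : ~~ tosr_le (1 : R) 0.
  apply/negP => le10; have /eqP[] := oner_neq0 R.
  by apply: tosr_le_anti; rewrite le10.
exists (fun i j t => `[< ample (a i j t) >]); split=> [M mM|s t Lst U oddU].
  have [s ms sM] := matching_perm_exists mM.
  have le1 : tosr_le 1 (spcoef (perm_monom s) (PM R n)).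
    rewrite spcoef_PM; set A := [set s | _]; have : (0 < #|A|)%N.
      by apply/card_gt0P; exists s; rewrite inE ms eqxx.
    case: #|A| => // N _; rewrite -natr1 -[X in tosr_le X]add0r.
    apply: tosr_leD; last exact: tosr_le_refl.
    elim: N => [|N IH]; first exact: nonneg0.
    by rewrite -natr1; exact: nonnegD.
  rewrite coefs in le1.
  have [[s' t] /eqP kE amp] := ample_sum n10 n1 (fun st _ => prod0 st) le1.
  exists s', t; split=> [i|U].
    by apply/asboolP; exact: (prod_ample (F := fun i =>
      a i (s' i) (t i)) i n1 (fun j => a0 _ _ _) amp).
  by rewrite -(perm_monom_crossing_matching U mM ms sM) -kE monom_crossing_sum.
pose k := \sum_i label_monom (t i).
have : spcoef k (PM R n) != 0.
  apply/eqP; rewrite coefs => sum0.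
  pose st := (s, [ffun i => t i]).
  have kst : \sum_i label_monom (st.2 i) == k.
    by apply/eqP; apply: eq_bigr => i _; rewrite ffunE.
  have [d d0 le1] : ample (\prod_i a i (st.1 i) (st.2 i)).
    by apply: ample_prod => // i; rewrite ffunE; apply/asboolP; exact: Lst.
  have := @tosr_le_sum R _ (fun st : 'S_m * {ffun 'I_m -> option (edge n)} =>
    \sum_i label_monom (st.2 i) == k) _ st (fun st _ => prod0 st) kst.
  rewrite sum0 => le0.
  have eq0 : \prod_i a i (st.1 i) (st.2 i) = 0 by apply: tosr_le_anti; rewrite le0;
    exact: prod0.
  by move: le1; rewrite eq0 mul0r (negPf n10).
rewrite spcoef_PM; have [->|[s']] := set_0Vmem [set s : 'S_n.*2 | matching_perm s &&
  (perm_monom s == k)].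
  by rewrite cards0 eqxx.
rewrite inE => /andP[ms' /eqP kE] _.
by rewrite -monom_crossing_sum -/k -kE perm_monom_crossing_gt0.
Qed.

(** * From labelled permutations to rectangles *)

Local Close Scope ring_scope.

Section Hall.
Variables (T : finType) (e : rel T).
Implicit Types A B D : {set T}.

Definition neighbours B A : {set T} := [set y in B | [exists x in A, e x y]].

Lemma neighboursU B A A' : neighbours B (A :|: A') = neighbours B A :|: neighbours B A'.
Proof.
apply/setP => y; rewrite !inE -andb_orr; congr (_ && _).
apply/existsP/orP => [[x]|].
  by rewrite inE => /andP[/orP[xA|xA] exy]; [left|right]; apply/existsP; exists x;
    rewrite xA.
by case=> /existsP[x /andP[xA exy]]; exists x; rewrite inE xA ?orbT.
Qed.

Lemma neighboursD B C A : neighbours (B :\: C) A = neighbours B A :\: C.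
Proof. by apply/setP => y; rewrite !inE andbA. Qed.

(** Induction on [#|D|]. A non-empty proper subset that is tight is matched into its neighbourhood,
    and the rest outside of it. If there is none, every such subset has a spare neighbour, so one
    point can be matched arbitrarily and removed. *)
Lemma hall_in D B : (forall A, A \subset D -> #|A| <= #|neighbours B A|) ->
  exists2 f : T -> T, {in D &, injective f} & forall x, x \in D -> f x \in B /\ e x (f x).
Proof.
have [n] := ubnP #|D|; elim: n => // n IH in D B *; rewrite ltnS => le_D hall.
have [->|/set0Pn[x0 x0D]] := eqVneq D set0.
  by exists id => x; rewrite inE.
have [/existsP[A /and4P[A0 AD neqA tight]]|no_tight] := boolP [exists A : {set T},
    [&& A != set0, A \subset D, A != D & #|neighbours B A| <= #|A|]].
  have lt_AD : #|A| < #|D| by apply: proper_card; rewrite properEneq neqA.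
  have [|A' sA'|f1 f1_inj f1P] := IH A B; first exact: leq_trans lt_AD le_D.
    by apply: hall; exact: subset_trans AD.
  have [||f2 f2_inj f2P] := IH (D :\: A) (B :\: neighbours B A).
  - apply: leq_trans le_D; rewrite cardsD (setIidPr AD).
    by rewrite ltn_subrL card_gt0 A0 (leq_ltn_trans (leq0n _) lt_AD).
  - move=> A' sA'; rewrite neighboursD.
    have disA : [disjoint A & A'].
      by rewrite disjoint_sym; apply: disjointWl sA' _;
        rewrite disjoints_subset setDE subsetIr.
    have sAA' : A :|: A' \subset D.
      by rewrite subUset AD (subset_trans sA') // subsetDl.
    have := hall _ sAA'; rewrite neighboursU !cardsU (disjoint_setI0 disA) cards0 subn0.
    have := cardsD (neighbours B A') (neighbours B A).
    have := subset_leq_card (subsetIl (neighbours B A') (neighbours B A)).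
    rewrite ![neighbours B A' :&: _]setIC; lia.
  have f1N x : x \in A -> f1 x \in neighbours B A.
    by move=> xA; have [f1B ex] := f1P _ xA; rewrite inE f1B; apply/existsP; exists x;
      rewrite xA.
  exists (fun x => if x \in A then f1 x else f2 x) => [x y xD yD|x xD]; last first.
    case: ifP => xA; first exact: f1P.
    have [] := f2P x; first by rewrite inE xA.
    by rewrite inE => /andP[].
  case: ifP => xA; case: ifP => yA; first exact: f1_inj.
  - move=> eq_f; have [] := f2P y; first by rewrite inE yA.
    by rewrite inE -eq_f f1N.
  - move=> eq_f; have [] := f2P x; first by rewrite inE xA.
    by rewrite inE eq_f f1N.
  - by apply: f2_inj; rewrite inE ?xA ?yA.
have [y0] : exists y0, y0 \in neighbours B [set x0].
  apply/set0Pn; rewrite -card_gt0; have := hall [set x0]; rewrite sub1set cards1 => ->//.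
rewrite inE => /andP[y0B /existsP[x /andP[/set1P-> e0]]].
have [||f f_inj fP] := IH (D :\ x0) (B :\ y0).
- by apply: leq_trans le_D; rewrite [#|D|](cardsD1 x0) x0D.
- move=> A sA; rewrite neighboursD.
  have [->|A0] := eqVneq A set0; first by rewrite cards0.
  have AD : A \subset D by apply: subset_trans sA _; exact: subsetDl.
  have : #|A| < #|neighbours B A|.
    rewrite ltnNge; apply: contra no_tight => le; apply/existsP; exists A.
    rewrite A0 AD le andbT /=; apply/eqP => eq_AD.
    by have := subsetP sA x0; rewrite eq_AD x0D !inE eqxx => /(_ isT).
  rewrite [#|neighbours B A|](cardsD1 y0); case: (y0 \in _); lia.
exists (fun x => if x == x0 then y0 else f x) => [y z yD zD|y yD]; last first.
  case: eqP => [->|/eqP neq] //; have [] := fP y; first by rewrite !inE neq.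
  by rewrite inE => /andP[].
case: eqP => [->|/eqP neq]; case: eqP => [->|/eqP neq'] //.
- by move=> eq_f; have [] := fP z; rewrite !inE ?neq' // -eq_f eqxx.
- by move=> eq_f; have [] := fP y; rewrite !inE ?neq // eq_f eqxx.
- by apply: f_inj; rewrite !inE ?neq ?neq'.
Qed.

Lemma hall_perm : (exists s : {perm T}, forall x, e x (s x)) \/
  exists A, #|neighbours setT A| < #|A|.
Proof.
have [/existsP ?|/existsPn noA] := boolP [exists A, #|neighbours setT A| < #|A|];
  first by right.
left; have [|f f_inj fP] := @hall_in setT setT.
  by move=> A _; rewrite leqNgt noA.
have f_inj' : injective f by move=> x y; apply: f_inj; rewrite inE.
by exists (perm f_inj') => x; rewrite permE; have [] := fP x; rewrite ?inE.
Qed.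

End Hall.

Lemma sum_ltn_ord m d : \sum_(c < m) (c < d) = minn d m.
Proof. by elim: m => [|m IH]; rewrite ?big_ord0 ?big_ord_recr /= ?IH; lia. Qed.

(** For odd [U], no permutation can use non-crossing labels throughout, so Hall gives a set of rows
    [A] whose neighbourhood [Y] is smaller. The rows outside [A] and the columns in [Y] are fewer
    than [m] lines covering all entries with a non-crossing label. The rectangles record entries
    covered twice, crossing labels on covered entries, and copies of the constant
    [m - 1 - #|~: A| - #|Y|]. *)
Lemma labels_slack_cover n m (L : 'I_m -> 'I_m -> option (edge n) -> bool) :
  (forall M : {perm 'I_n.*2}, is_matching M ->
      exists (s : 'S_m) (t : 'I_m -> option (edge n)), (forall i, L i (s i) (t i)) /\
        forall U, crossing U M = \sum_i crosses U (t i)) ->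
  (forall (s : 'S_m) (t : 'I_m -> option (edge n)), (forall i, L i (s i) (t i)) ->
        forall U : {set 'I_n.*2}, odd #|U| -> 0 < \sum_i crosses U (t i)) ->
  exists (P : 'I_m * 'I_m + 'I_m * 'I_m * edge n + 'I_m -> pred {set 'I_n.*2})
    (R : 'I_m * 'I_m + 'I_m * 'I_m * edge n + 'I_m -> pred {perm 'I_n.*2}),
    slack_cover P R.
Proof.
move=> realised crossed.
pose H (U : {set 'I_n.*2}) (i j : 'I_m) := [exists t, L i j t && ~~ crosses U t].
have exA (U : {set 'I_n.*2}) : exists A : {set 'I_m},
    odd #|U| -> #|neighbours (H U) setT A| < #|A|.
  have [[s sP]|[A ltA]] := hall_perm (H U); last by exists A.
  exists set0 => oddU; have [t tP] := fin_all_exists (fun i => existsP (sP i)).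
  have Lt i : L i (s i) (t i) by have /andP[] := tP i.
  have := crossed s t Lt U oddU; rewrite big1 // => i _.
  by have /andP[_ /negPf ->] := tP i.
have [A AP] := fin_all_exists exA.
have exst (M : {perm 'I_n.*2}) : exists st : 'S_m * ('I_m -> option (edge n)),
    is_matching M -> (forall i, L i (st.1 i) (st.2 i)) /\
        forall U, crossing U M = \sum_i crosses U (st.2 i).
  have [mM|nM] := boolP (is_matching M); last by exists (1%g, fun=> None).
  by have [s [t st]] := realised M mM; exists (s, t).
have [st stP] := fin_all_exists exst.
pose Y U := neighbours (H U) setT (A U).
pose J := ('I_m * 'I_m + 'I_m * 'I_m * edge n + 'I_m)%type.
pose P (x : J) (U : {set 'I_n.*2}) : bool := match x with
  | inl (inl (i, j)) => (i \notin A U) && (j \in Y U)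
  | inl (inr (i, j, e)) => crosses U (Some e) && ((i \notin A U) || (j \in Y U))
  | inr c => c < m - 1 - #|~: A U| - #|Y U|
  end.
pose R (x : J) (M : {perm 'I_n.*2}) : bool := match x with
  | inl (inl (i, j)) => (st M).1 i == j
  | inl (inr (i, j, e)) => ((st M).1 i == j) && ((st M).2 i == Some e)
  | inr c => true
  end.
exists P, R.
move=> U M oddU mM; have ltA := AP U oddU; have [LM ->] := stP M mM.
rewrite !big_sumType.
set s := (st M).1 in LM *; set t := (st M).2 in LM *.
have -> : \sum_p (P (inl (inl p)) U && R (inl (inl p)) M)
    = \sum_i ((i \notin A U) && (s i \in Y U)).
  rewrite (eq_bigr (fun p => ((p.1 \notin A U) && (p.2 \in Y U) &&
    (s p.1 == p.2) : nat))); last by case.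
  rewrite -(pair_bigA _ (fun i j => ((i \notin A U) && (j \in Y U) &&
    (s i == j) : nat))) /=.
  apply: eq_bigr => i _; rewrite (bigD1 (s i)) //= eqxx andbT big1 ?addn0 // => j.
  by rewrite eq_sym => /negPf ->; rewrite andbF.
have -> : \sum_p (P (inl (inr p)) U && R (inl (inr p)) M)
    = \sum_i (crosses U (t i) && ((i \notin A U) || (s i \in Y U))).
  pose F i j e : nat := crosses U (Some e) && ((i \notin A U) || (j \in Y U))
      && ((s i == j) && (t i == Some e)).
  rewrite (eq_bigr (fun p => F p.1.1 p.1.2 p.2)); last by case=> -[].
  rewrite -(pair_bigA _ (fun ij e => F ij.1 ij.2 e)) /=.
  rewrite -(pair_bigA _ (fun i j => \sum_e F i j e)) /=.
  apply: eq_bigr => i _; rewrite (bigD1 (s i)) //= [X in _ + X]big1 ?addn0; last first.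
    by move=> j; rewrite eq_sym => /negPf ne; rewrite big1 // => e _; rewrite /F ne andbF.
  rewrite /F eqxx; case: (t i) => [e|]; last by rewrite big1 // => e _; rewrite andbF.
  rewrite (bigD1 e) //= eqxx andbT big1 ?addn0 // => e' ne.
  by rewrite (inj_eq Some_inj) eq_sym (negPf ne) andbF.
have -> : \sum_(c < m) (P (inr c) U && R (inr c) M)
    = m - 1 - #|~: A U| - #|Y U|.
  rewrite (eq_bigr (fun c : 'I_m => c < m - 1 - #|~: A U| - #|Y U| : nat)) => [|c _];
    last by rewrite andbT.
  by rewrite sum_ltn_ord; apply/minn_idPl; lia.
have cardA : #|~: A U| = \sum_i (i \notin A U).
  by rewrite -sum1_card big_mkcond; apply: eq_bigr => i _; rewrite inE; case: (i \in _).
have cardY : #|Y U| = \sum_i (s i \in Y U).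
  rewrite -sum1_card big_mkcond (reindex_inj (@perm_inj _ s)); apply: eq_bigr => i _ /=.
  by case: (s i \in _).
have cardm : m = \sum_(i < m) 1 by rewrite sum_nat_const card_ord muln1.
(* Row by row: an uncovered entry must have a crossing label, and one covered once or twice
   contributes 1 or 2 on the left besides its label. *)
have key : \sum_i crosses U (t i) + \sum_i (i \notin A U) + \sum_i (s i \in Y U) =
   \sum_(i < m) 1 + \sum_i ((i \notin A U) && (s i \in Y U))
   + \sum_i (crosses U (t i) && ((i \notin A U) || (s i \in Y U))).
  rewrite -!big_split /=; apply: eq_bigr => i _.
  case iA : (i \in A U); case siY : (s i \in Y U); case tc : (crosses U (t i)) => //=.
  have : s i \in Y U.
    rewrite !inE /=; apply/existsP; exists i; rewrite iA; apply/existsP; exists (t i).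
    by rewrite LM tc.
  by rewrite siY.
have lt_m : #|~: A U| + #|Y U| < m.
  by have := cardsC (A U); rewrite card_ord; rewrite -/(Y U) in ltA; lia.
by rewrite -cardA -cardY -cardm in key; rewrite -[RHS]/(1 + (_ + _ + _)); lia.
Qed.

(** * Size of projections *)

(** With [w = 2 (d + 1)], [u + 1 <= w * 2 ^ (u / w)] bounds the power by a constant times
    [2 ^ (u / 2)], and the other half of the exponent beats the constant. *)
Lemma poly_lt_exp c d : exists u0, forall u, u0 <= u -> c * u.+1 ^ d < 2 ^ u.
Proof.
pose w := 2 * d.+1; pose b := c * w ^ d.+1.
exists (2 * b).+1 => u le_u.
have wE : u.+1 <= w * 2 ^ (u %/ w).
  have : u.+1 <= w * (u %/ w).+1.
    by have := ltn_ceil u (isT : 0 < w); rewrite mulnC.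
  by move/leq_trans; apply; rewrite leq_mul2l ltn_expl // orbT.
have le1 : c * u.+1 ^ d <= b * 2 ^ (u %/ 2).
  apply: leq_trans (_ : c * u.+1 ^ d.+1 <= _);
    first by rewrite leq_mul2l leq_pexp2l ?orbT.
  rewrite /b -mulnA leq_mul2l; apply/orP; right.
  apply: leq_trans (_ : (w * 2 ^ (u %/ w)) ^ d.+1 <= _); first by rewrite leq_exp2r.
  rewrite expnMn -expnM leq_mul2l; apply/orP; right; rewrite leq_exp2l //.
  rewrite leq_divRL // -mulnA [d.+1 * 2]mulnC; exact: leq_divM.
apply: leq_ltn_trans le1 _.
have b_lt : b < 2 ^ (u - u %/ 2).
  apply: leq_trans (ltn_expl b (isT : 1 < 2)) _; rewrite leq_exp2l //.
  have := leq_divM u 2; lia.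
have -> : 2 ^ u = 2 ^ (u - u %/ 2) * 2 ^ (u %/ 2) by rewrite -expnD subnK // leq_div.
by rewrite ltn_pmul2r // expn_gt0.
Qed.

Lemma horner_nat_bound (q : {poly nat}) : exists c d, forall n, (q.[n])%R <= c * n.+1 ^ d.
Proof.
exists (\sum_(i < size q) q`_i)%R, (size q) => n.
rewrite horner_coef.
have -> : (\sum_(i < size q) q`_i)%R * n.+1 ^ size q = \sum_(i < size q) (q`_i)%R *
  n.+1 ^ size q.
  by rewrite big_distrl.
apply: leq_sum => i _; apply: (@leq_mul (q`_i)%R) => //; rewrite natrXE.
apply: leq_trans (_ : n.+1 ^ i <= _); first by case: (nat_of_ord i) => // j;
  rewrite leq_exp2r.
by rewrite leq_pexp2l // ltnW.
Qed.

Lemma PM_projection_size : exists L n0, 0 < L /\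
  forall (R : totalOrderSemiRingType) n m, n0 <= n ->
    monotone_affine_projection (PM R n) (permanent R m) -> 2 ^ n <= m ^ L.
Proof.
have [e [n1 [e_gt0 cover]]] := slack_cover_exponential.
have [u0 expP] := poly_lt_exp (2 + 16 * e ^ 2) 2.
exists (8 * e), (maxn n1 (2 * e * u0.+1)); split=> [|R n m]; first by rewrite muln_gt0.
rewrite geq_max => /andP[le_n1 le_n2] proj.
have n_gt0 : 0 < n by apply: leq_trans le_n2; rewrite !muln_gt0 e_gt0.
have [L [realised crossed]] := projection_labels n_gt0 proj.
have [P [Q cov]] := labels_slack_cover realised crossed.
have {cover} := cover n _ P Q le_n1 cov.
have card_edge : #|edge n| <= 4 * n ^ 2.
  apply: leq_trans (leq_card val val_inj) _.
  by rewrite card_prod card_ord -muln2; lia.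
rewrite !card_sum !card_prod !card_ord => le_pow.
set u := n %/ (2 * e); have u_lt : n < 2 * e * u.+1 by rewrite mulnC ltn_ceil // muln_gt0.
have le_u0 : u0.+1 <= u by rewrite leq_divRL ?muln_gt0 // mulnC.
have le_n : 2 + 4 * n ^ 2 <= 2 ^ u.
  apply: leq_trans (ltnW (expP u _)); last exact: ltnW.
  nia.
have le_2u : 2 ^ u * 2 ^ u <= m ^ 2 * 2 ^ u.
  apply: (@leq_trans (m ^ 2 * (2 + 4 * n ^ 2))); last by rewrite leq_mul2l le_n orbT.
  apply: (@leq_trans (2 ^ (n %/ e))).
    rewrite -expnD leq_exp2l // leq_divRL // /u.
    have := leq_divM n (2 * e); lia.
  apply: leq_trans le_pow _.
  have : m * m * #|edge n| <= m ^ 2 * (4 * n ^ 2) by rewrite leq_mul.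
  nia.
have le_um : 2 ^ u <= m ^ 2 by rewrite leq_pmul2r ?expn_gt0 in le_2u.
apply: (@leq_trans ((2 ^ u) ^ (4 * e))).
  by rewrite -expnM leq_exp2l //; nia.
have -> : m ^ (8 * e) = (m ^ 2) ^ (4 * e) by rewrite -expnM; congr (_ ^ _); lia.
by rewrite leq_exp2r // muln_gt0.
Qed.

Local Open Scope ring_scope.

Theorem theorem4p3 (K : realType) :
  exists2 eps : K, 0 < eps
    & forall R : totalOrderSemiRingType,
        (exists n0 : nat, forall n : nat, (n0 <= n)%N -> forall m : nat,
           monotone_affine_projection (PM R n) (permanent R m) ->
           2 `^ (eps * n%:R) <= m%:R)
        /\ ~ monotone_affine_p_projection (PM R) (permanent R).
Proof.
have [L [n0 [L_gt0 size_bound]]] := PM_projection_size.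
have L0 : 0 < L%:R :> K by rewrite ltr0n.
exists L%:R^-1 => [|R]; first by rewrite invr_gt0.
split=> [|[p [q p_le] [n1 proj]]].
  exists n0 => n le_n m /(size_bound R n m le_n) le_pow.
  rewrite -(@ler_pXn2r _ L) ?nnegrE ?powR_ge0 //.
  rewrite -powR_mulrn ?powR_ge0 // -powRrM mulrAC mulVf ?lt0r_neq0 // mul1r.
  by rewrite powR_mulrn // -!natrX ler_nat.
have [c [d q_le]] := horner_nat_bound q.
(* [p n ^ L] is at most [c ^ L * n.+1 ^ (d * L)], to be compared with [2 ^ n <= p n ^ L]. *)
have [u0 exp_gt] := poly_lt_exp (c ^ L) (d * L).
pose n := maxn n0 (maxn n1 u0).
have le_n0 : (n0 <= n)%N by rewrite leq_max leqnn.
have le_n1 : (n1 <= n)%N by rewrite !leq_max leqnn orbT.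
have le_u0 : (u0 <= n)%N by rewrite !leq_max leqnn !orbT.
have := size_bound R n (p n) le_n0 (proj n le_n1).
rewrite leqNgt; case/negP; apply: leq_ltn_trans (exp_gt n le_u0).
by rewrite expnM -expnMn leq_exp2r // (leq_trans (p_le n)).
Qed.
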